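(* Let $k$ be a field of characteristic $0$. The morphism of $\mathbb S$-modules $sh=\bigoplus_{n\ge1}sh_n:\mathrm{As}\to\mathrm{As}$ decomposes $\mathrm{As}$ as the direct sum over $n\ge1$ of its $2^n$-eigenspaces, each of which is a sub-$\mathrm{Lie}$-bimodule of $\mathrm{As}$. The $2^n$-eigenspace is generated as a right $\mathrm{Lie}$-module by $s_n=\frac1{n!}\sum_{\sigma\in\mathbb S_n}\sigma\in\mathrm{As}(n)$, and this decomposition agrees with the decomposition of $\mathrm{Lie}$-bimodules $\mathrm{As}\cong\bigoplus_{n\ge1}\mathrm{Com}(n)\circ\mathrm{Lie}$ arising from the filtered distributive law $(\mathrm{Com},\mathrm{Lie},s,d)$ for $\mathrm{As}$ with splitting $\mathrm{Com}\to\mathrm{As}$ picking out the elements $s_n$.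
   Context: $\mathrm{As}$, $\mathrm{Com}$, $\mathrm{Lie}$ are the operads of (non-unital) associative, commutative associative, and Lie algebras. $\mathrm{As}(n)\cong k\mathbb S_n$, where $\sigma\in\mathbb S_n$ corresponds to the multilinear monomial $x_{\sigma(1)}\cdots x_{\sigma(n)}$; the right $\mathbb S_n$-action relabels variables. The product in $\mathbb S_n$ is taken so that $(\sigma\tau)(k)=\tau(\sigma(k))$, so the right action is right multiplication and left multiplication permutes positions. For $A\subseteq[n]=\{1,\dots,n\}$ with $A=\{i_1<\dots<i_p\}$ and $[n]\setminus A=\{j_1<\dots<j_q\}$, let $\sigma_A\in\mathbb S_n$ be $\sigma_A(k)=i_k$ for $k\le p$ and $\sigma_A(k)=j_{k-p}$ for $k>p$. Put $sh_n=\sum_{A\subseteq[n]}\sigma_A\in k\mathbb S_n$, acting on $\mathrm{As}(n)$ by left multiplication: $x_{w(1)}\cdots x_{w(n)}\mapsto\sum_{A\subseteq[n]}x_{w(\sigma_A(1))}\cdots x_{w(\sigma_A(n))}$. $\mathrm{As}$ is a $\mathrm{Lie}$-bimodule via the operad map $\mathrm{Lie}\to\mathrm{As}$ sending the bracket to $x_1x_2-x_2x_1$. A bimodule over an operad $\mathcal O$ is an $\mathbb S$-module $\mathcal M$ with associative, compatible right and left actions by partial compositions $\mathcal M\circ_1\mathcal O\to\mathcal M$, $\mathcal O\circ_1\mathcal M\to\mathcal M$ (the left action being linear in $\mathcal M$), where $(\mathcal A\circ_1\mathcal B)(X)=\bigoplus_{Y\subseteq X}\mathcal A((X\setminus Y)\amalg\{\ast\})\otimes\mathcal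 B(Y)$. $(\mathcal A\circ\mathcal B)(X)=\bigoplus_{r\ge1}\mathcal A(r)\otimes_{\mathbb S_r}\bigoplus_{X=X_1\amalg\cdots\amalg X_r}\bigotimes_i\mathcal B(X_i)$. The filtered distributive law for $\mathrm{As}$ presents it with generators the symmetrised product $\frac12(x_1x_2+x_2x_1)$ and the bracket; the corresponding isomorphism $\zeta:\mathrm{Com}\circ\mathrm{Lie}\to\mathrm{As}$ is the composite of the $\mathbb S$-module map $\mathrm{Com}\to\mathrm{As}$ sending the generator of $\mathrm{Com}(n)$ to $s_n$, the map $\mathrm{Lie}\to\mathrm{As}$, and composition in $\mathrm{As}$. ''Agrees'' means that the $2^n$-eigenspace is $\zeta(\mathrm{Com}(n)\circ\mathrm{Lie})$, with $\mathrm{Com}(n)$ the arity $n$ part of $\mathrm{Com}$. *)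

(* Defs.v *)
From HB Require Import structures.
From mathcomp Require Import all_boot all_algebra perm.
From mathcomp Require Import finmap monalg.
From mathcomp Require Import boolp.

Set Implicit Arguments.
Unset Strict Implicit.
Unset Printing Implicit Defensive.

Import GRing.Theory.
Local Open Scope ring_scope.
Local Open Scope quotient_scope.

(* Operads and S-modules are taken in coordinate-free form: components are    *)
(* indexed by finite types X, and the arity n component is the value at 'I_n. *)

Section Quotient.
Variables (k : fieldType) (V : lmodType k) (rel : V -> Prop).

Inductive lspan : V -> Prop :=
| lspan0 : lspan 0
| lspanS (c : k) (r v : V) : rel r -> lspan v -> lspan (c *: r + v).

Lemma lspanZD (c : k) u v : lspan u -> lspan v -> lspan (c *: u + v).
Proof.
move=> Su Sv; elim: Su => [|d r w Rr _ IH]; first by rewrite scaler0 add0r.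
by rewrite scalerDr -addrA scalerA; apply: lspanS.
Qed.

Lemma lspan_rel r : rel r -> lspan r.
Proof. by move=> Rr; rewrite -[r]addr0 -[r]scale1r; do 2?constructor. Qed.

Definition lspan_pred : {pred V} := fun v => `[< lspan v >].

Lemma lspan_predP v : reflect (lspan v) (v \in lspan_pred).
Proof. exact: asboolP. Qed.

Fact lspan_zmod_closed : zmod_closed lspan_pred.
Proof.
split=> [|u v /lspan_predP Su /lspan_predP Sv]; apply/lspan_predP.
  exact: lspan0.
by rewrite addrC -scaleN1r; apply: lspanZD.
Qed.

HB.instance Definition _ := GRing.isZmodClosed.Build V lspan_pred
  lspan_zmod_closed.


(* The quotient of V by the subspace spanned by the vectors satisfying rel.    *)
Definition lquot : Type := {ideal_quot lspan_pred}.
HB.instance Definition _ := GRing.Zmodule.on lquot.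

Definition lq_pi (v : V) : lquot := \pi_({ideal_quot lspan_pred}) v.
Definition lq_repr (x : lquot) : V := repr (x : {ideal_quot lspan_pred}).

Lemma lq_reprK : cancel lq_repr lq_pi.
Proof. exact: reprK. Qed.

Lemma lq_piP u v : lq_pi u = lq_pi v <-> lspan (u - v).
Proof.
split=> [/eqP e|h]; first by apply/lspan_predP; rewrite Quotient.idealrBE.
by apply/eqP; move/lspan_predP: h; rewrite Quotient.idealrBE.
Qed.

Lemma lq_pi_is_zmod : zmod_morphism lq_pi.
Proof.
move=> u v; rewrite /lq_pi.
by rewrite [X in X = _]Quotient.pi_add [X in _ + X = _]Quotient.pi_opp.
Qed.

HB.instance Definition _ := GRing.isZmodMorphism.Build V lquot lq_pi
  lq_pi_is_zmod.

Definition lq_scale (c : k) (x : lquot) : lquot := lq_pi (c *: lq_repr x).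

Lemma lq_piZ c v : lq_pi (c *: v) = lq_scale c (lq_pi v).
Proof.
apply/lq_piP; rewrite -scalerBr -[_ *: _]addr0; apply: lspanZD; last exact: lspan0.
by apply/lq_piP; rewrite lq_reprK.
Qed.

Fact lq_scaleA a b x : lq_scale a (lq_scale b x) = lq_scale (a * b) x.
Proof. by rewrite -[x]lq_reprK -!lq_piZ scalerA. Qed.
Fact lq_scale1 : left_id 1 lq_scale.
Proof. by move=> x; rewrite -[x]lq_reprK -lq_piZ scale1r. Qed.
Fact lq_scaleDr : right_distributive lq_scale +%R.
Proof.
move=> a x y; rewrite -[x]lq_reprK -[y]lq_reprK -raddfD -!lq_piZ -raddfD.
by rewrite scalerDr.
Qed.
Fact lq_scaleDl x : {morph lq_scale^~ x : a b / a + b}.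
Proof. by move=> a b; rewrite -[x]lq_reprK -!lq_piZ -raddfD scalerDl. Qed.

HB.instance Definition _ := GRing.Zmodule_isLmodule.Build k lquot
  lq_scaleA lq_scale1 lq_scaleDr lq_scaleDl.
HB.instance Definition _ := GRing.isScalable.Build k V lquot *:%R lq_pi lq_piZ.

Section Lift.
Variables (W : lmodType k) (f : {linear V -> W}).
Hypothesis f_rel : forall r, rel r -> f r = 0.

Lemma lspan_lift v : lspan v -> f v = 0.
Proof.
by elim=> [|c r w Rr _ IH]; rewrite ?linear0 // linearP f_rel // scaler0 add0r.
Qed.

Definition lq_lift of (forall r, rel r -> f r = 0) : lquot -> W :=
  fun x => f (lq_repr x).

Lemma lq_lift_pi v : lq_lift f_rel (lq_pi v) = f v.
Proof.
apply/eqP; rewrite -subr_eq0 -linearB; apply/eqP/lspan_lift/lq_piP.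
exact: lq_reprK.
Qed.

Fact lq_lift_linear : linear (lq_lift f_rel).
Proof.
move=> c x y; rewrite -[x]lq_reprK -[y]lq_reprK -linearP !lq_lift_pi.
exact: linearP.
Qed.
HB.instance Definition _ := GRing.isLinear.Build k lquot W *:%R
  (lq_lift f_rel) lq_lift_linear.
End Lift.
End Quotient.

Section FreeLift.
Variables (k : fieldType) (K : choiceType) (W : lmodType k) (h : K -> W).

Definition malg_lift (u : {malg k[K]}) : W := \sum_(t <- msupp u) u@_t *: h t.

Lemma malg_liftE (d : {fset K}) u : (msupp u `<=` d)%fset ->
  malg_lift u = \sum_(t <- d) u@_t *: h t.
Proof.
move=> le; rewrite /malg_lift; apply: (big_fset_incl _ le) => t _.
by rewrite -mcoeff_eq0 => /eqP ->; rewrite scale0r.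
Qed.

Fact malg_lift_linear : linear malg_lift.
Proof.
move=> c u v; pose d := (msupp (c *: u + v) `|` msupp u `|` msupp v)%fset.
have d1 : (msupp (c *: u + v) `<=` d)%fset by rewrite /d -fsetUA fsubsetUl.
have d2 : (msupp u `<=` d)%fset by rewrite /d fsetUAC fsubsetUr.
have d3 : (msupp v `<=` d)%fset by rewrite fsubsetUr.
rewrite (malg_liftE d1) (malg_liftE d2) (malg_liftE d3).
rewrite scaler_sumr -big_split /=; apply: eq_bigr => t _.
by rewrite mcoeffD mcoeffZ scalerDl scalerA.
Qed.
HB.instance Definition _ := GRing.isLinear.Build k {malg k[K]} W *:%R
  malg_lift malg_lift_linear.

Lemma malg_liftU t : malg_lift << t >> = h t.
Proof. by rewrite (malg_liftE msuppU_le) big_seq_fset1 mcoeffUU scale1r. Qed.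
End FreeLift.

(* ------------------------------------------------------------------------- *)

Section Listing.
Variable X : finType.

(* Listings of X without repetition, i.e. multilinear monomials on X; there   *)
(* is none on the empty set, since the operads are non-unital.                *)
Definition listing_pred (w : #|X|.-tuple X) := uniq w && (0 < #|X|)%N.
Definition listing := {w | listing_pred w}.
Definition word (w : listing) : seq X := val w.

Lemma word_inj : injective word.
Proof. by move=> u v e; do 2!apply: val_inj. Qed.

Lemma word_uniq w : uniq (word w).
Proof. by case/andP: (valP w). Qed.

Lemma size_word w : size (word w) = #|X|.
Proof. by rewrite size_tuple. Qed.

Lemma mem_word w x : x \in word w.
Proof.
have /card_uniqP e := word_uniq w.
have /eqP e' : #|word w| == #|X| by rewrite e size_word.
by have /(_ x) := (subset_cardP e') (subset_predT _).
Qed.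

Lemma listingP (s : seq X) : uniq s -> s =i predT -> (0 < size s)%N ->
  {w : listing | word w = s}.
Proof.
move=> us ms s0; have es : size s = #|X|.
  by rewrite -(card_uniqP us); apply: eq_card.
have X0 : (0 < #|X|)%N by rewrite -es.
have lt : listing_pred (tcast es (in_tuple s)).
  by rewrite /listing_pred X0 andbT val_tcast.
by exists (Sub (tcast es (in_tuple s)) lt); rewrite /word /= val_tcast.
Qed.
End Listing.

Section As.
Variable k : fieldType.

(* The component As(X): linear combinations of listings of X.                 *)
Local Notation As X := {ffun listing X -> k^o}.

Definition mono (X : finType) (s : seq X) : As X := [ffun w => (word w == s)%:R].

Definition as_lift (X : finType) (W : lmodType k) (h : listing X -> W) (u : As X) : W :=
  \sum_w (u w : k) *: h w.

Fact as_lift_linear (X : finType) (W : lmodType k) h : linear (@as_lift X W h).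
Proof.
move=> c u v; rewrite /as_lift scaler_sumr -big_split /=; apply: eq_bigr => w _.
by rewrite !ffunE scalerDl scalerA.
Qed.
HB.instance Definition _ (X : finType) (W : lmodType k) (h : listing X -> W) :=
  GRing.isLinear.Build k (As X) W *:%R
  (@as_lift X W h) (as_lift_linear h).

Lemma as_lift_mono (X : finType) (W : lmodType k) (h : listing X -> W) w :
  as_lift h (mono (word w)) = h w.
Proof.
rewrite /as_lift (bigD1 w) //= ffunE eqxx scale1r big1 ?addr0 // => v nvw.
by rewrite ffunE (inj_eq (@word_inj X)) (negPf nvw) scale0r.
Qed.

(* The S-module structure: relabelling along f (meant for bijective f).       *)
Definition as_map (X Y : finType) (f : X -> Y) : As X -> As Y :=
  as_lift (fun w => mono (map f (word w))).
HB.instance Definition _ (X Y : finType) (f : X -> Y) := GRing.Linear.on (as_map f).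

(* The partial composition u o_* v, with * = None: the word b is substituted  *)
(* for the letter * in the word a.                                            *)
Definition word_subst (X : finType) (Y : {set X}) (a : seq (option {x : X | x \notin Y}))
    (b : seq {x : X | x \in Y}) : seq X :=
  flatten [seq if o is Some x then [:: val x] else map val b | o <- a].

Definition as_pcomp (X : finType) (Y : {set X}) (u : As (option {x : X | x \notin Y}))
    (v : As {x : X | x \in Y}) : As X :=
  \sum_a \sum_b (u a * v b : k) *: mono (word_subst (word a) (word b)).

(* The composition along p : X -> R, i.e. the S-module map As o As -> As: the *)
(* word over the fibre of p at i is substituted for the letter i.             *)
Definition fib (X R : finType) (p : X -> R) (i : R) : finType :=
  {x : X | p x == i}.

Definition as_comp (X R : finType) (p : X -> R) (u : As R)
    (v : forall i, As (fib p i)) : As X :=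
  \sum_a \sum_(b : {dffun forall i, listing (fib p i)})
    (u a * \prod_i (v i (b i) : k)) *:
      mono (flatten [seq map val (word (b i)) | i <- word a]).

(* s_X is the average of all listings of X; s_n is its value at X = 'I_n.     *)
Definition as_sym (X : finType) : As X :=
  ((#|X|)`!%:R : k)^-1 *: \sum_w mono (word w).

Section Shuffle.
Variable n : nat.

Definition sigma_fun (A : {set 'I_n}) (i : 'I_n) : 'I_n :=
  nth i (enum A ++ enum (~: A)) i.

Lemma sigma_fun_inj A : injective (sigma_fun A).
Proof.
have us : uniq (enum A ++ enum (~: A)).
  rewrite cat_uniq !enum_uniq andbT /=; apply/hasPn => x.
  by rewrite !mem_enum inE.
have ss : size (enum A ++ enum (~: A)) = n.
  by rewrite size_cat -!cardE cardsC card_ord.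
move=> i j; rewrite /sigma_fun (set_nth_default i) ?ss // => /eqP.
by rewrite nth_uniq ?ss // => /eqP /val_inj.
Qed.

Definition sigma (A : {set 'I_n}) : 'S_n := perm (@sigma_fun_inj A).
End Shuffle.

(* Left multiplication permutes positions.                                    *)
Definition left_mul (X : finType) (s : 'S_#|X|) (w : listing X) : seq X :=
  [seq tnth (val w) (s i) | i <- enum 'I_#|X|].

Definition sh (X : finType) : 'End(As X) :=
  linfun (as_lift (fun w : listing X =>
    \sum_(A : {set 'I_#|X|}) mono (left_mul (sigma A) w))).
End As.
Notation As k X := {ffun listing X -> k^o}.
Arguments mono {k X} s.
Arguments as_sym k X : clear implicits.
Arguments sh k X : clear implicits.

Definition sh_eigenspace (k : fieldType) (n : nat) (X : finType) :
  {vspace As k X} := passmx.leigenspace (sh k X) (2%:R ^+ n).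

(* ------------------------------------------------------------------------- *)

Record smodule (k : fieldType) := SModule {
  sm_obj :> finType -> lmodType k;
  sm_map : forall (X Y : finType) (f : X -> Y), bijective f ->
    {linear sm_obj X -> sm_obj Y};
  sm_map_id : forall (X : finType) (f : X -> X) (bf : bijective f),
    f =1 id -> sm_map bf =1 id;
  sm_map_comp : forall (X Y Z : finType) (f : X -> Y) (g : Y -> Z) (h : X -> Z)
    (bf : bijective f) (bg : bijective g) (bh : bijective h),
    h =1 g \o f -> sm_map bh =1 sm_map bg \o sm_map bf }.

Section Com.
Variable k : fieldType.
Implicit Types X Y Z : finType.

(* Com(X) is k for X nonempty and 0 for X empty.                              *)
Definition com (X : finType) : lmodType k :=
  {ffun {e : unit | (0 < #|X|)%N} -> k^o}.

Definition com_map (X Y : finType) (f : X -> Y) (u : com X) : com Y :=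
  [ffun _ => \sum_e u e].

Fact com_map_linear X Y (f : X -> Y) : linear (com_map f).
Proof.
move=> c u v; apply/ffunP => e; rewrite !ffunE scaler_sumr -big_split /=.
by apply: eq_bigr => e' _; rewrite !ffunE.
Qed.
HB.instance Definition _ (X Y : finType) (f : X -> Y) :=
  GRing.isLinear.Build k (com X) (com Y) *:%R (com_map f) (com_map_linear f).

Lemma com_mapE X Y (f : X -> Y) (u : com X) e e' : com_map f u e = u e'.
Proof.
by rewrite ffunE (big_pred1 e') // => e''; apply/esym/eqP/val_inj.
Qed.

Fact com_map_id X (f : X -> X) : bijective f -> f =1 id -> com_map f =1 id.
Proof. by move=> _ _ u; apply/ffunP => e; apply: com_mapE. Qed.

Fact com_map_comp X Y Z (f : X -> Y) (g : Y -> Z) (h : X -> Z) :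
  bijective f -> bijective g -> bijective h -> h =1 g \o f ->
  com_map h =1 com_map g \o com_map f.
Proof.
move=> bf bg _ _ u; apply/ffunP => e.
have e1 : {e : unit | (0 < #|X|)%N}.
  exists tt; have := valP e; rewrite -(bij_eq_card bg).
  by rewrite -(bij_eq_card bf).
have e2 : {e : unit | (0 < #|Y|)%N}.
  by exists tt; rewrite -(bij_eq_card bf); apply: (valP e1).
by rewrite /= (com_mapE h u e e1) (com_mapE g _ e e2) (com_mapE f u e2 e1).
Qed.

Definition Com : smodule k :=
  @SModule k com (fun X Y f _ => com_map f) com_map_id com_map_comp.

(* The splitting Com -> As, sending the generator of Com(n) to s_n.           *)
Definition com_as (X : finType) (u : com X) : As k X :=
  (\sum_e u e : k) *: as_sym k X.
End Com.

Inductive bracket (X : Type) : Type :=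
| bvar of X
| br of bracket X & bracket X.
Arguments bvar {X} x.
Arguments br {X} a b.

Section BracketChoice.
Variable X : choiceType.

Fixpoint bracket_encode (t : bracket X) : GenTree.tree X :=
  match t with
  | bvar x => GenTree.Leaf x
  | br a b => GenTree.Node 0 [:: bracket_encode a; bracket_encode b]
  end.

Fixpoint bracket_decode (t : GenTree.tree X) : option (bracket X) :=
  match t with
  | GenTree.Leaf x => Some (bvar x)
  | GenTree.Node _ [:: a; b] =>
      if (bracket_decode a, bracket_decode b) is (Some a', Some b')
      then Some (br a' b') else None
  | _ => None
  end.

Lemma bracket_encodeK : pcancel bracket_encode bracket_decode.
Proof. by elim=> //= a -> b ->. Qed.

HB.instance Definition _ := Choice.copy (bracket X) (pcan_type bracket_encodeK).
End BracketChoice.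

Fixpoint leaves X (t : bracket X) : seq X :=
  match t with bvar x => [:: x] | br a b => leaves a ++ leaves b end.

Fixpoint bracket_map X Y (f : X -> Y) (t : bracket X) : bracket Y :=
  match t with
  | bvar x => bvar (f x)
  | br a b => br (bracket_map f a) (bracket_map f b)
  end.

Lemma leaves_map X Y (f : X -> Y) t :
  leaves (bracket_map f t) = map f (leaves t).
Proof. by elim: t => //= a -> b ->; rewrite map_cat. Qed.

(* relator s means that the sum of the members of s vanishes in every Lie     *)
(* algebra, by antisymmetry or the Jacobi identity applied inside a bracket.  *)
Inductive relator X : seq (bracket X) -> Prop :=
| rel_anti a b : relator [:: br a b; br b a]
| rel_jacobi a b c :
    relator [:: br (br a b) c; br (br b c) a; br (br c a) b]
| rel_left t s : relator s -> relator [seq br a t | a <- s]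
| rel_right t s : relator s -> relator [seq br t a | a <- s].

Lemma relator_map X Y (f : X -> Y) s :
  relator s -> relator (map (bracket_map f) s).
Proof.
elim=> [a b|a b c|t {}s _ IH|t {}s _ IH] /=; do ?constructor.
  by rewrite -map_comp (map_comp (fun a => br a (bracket_map f t)));
    constructor.
by rewrite -map_comp (map_comp (br (bracket_map f t))); constructor.
Qed.

Lemma malgUE (k : fieldType) (K : choiceType) (c : k) (t : K) :
  << c *g t >> = c *: << t >> :> {malg k[K]}.
Proof. by apply/malgP => t'; rewrite mcoeffZ !mcoeffU mulrnAr mulr1. Qed.

Lemma linear_eq_sum (k : fieldType) (U W : lmodType k) (f g : {linear U -> W})
    (T : Type) (r : seq T) (c : T -> k) (h : T -> U) :
  (forall t, f (h t) = g (h t)) ->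
  f (\sum_(t <- r) c t *: h t) = g (\sum_(t <- r) c t *: h t).
Proof.
by move=> e; rewrite !linear_sum; apply: eq_bigr => t _; rewrite !linearZ /= e.
Qed.

Section Lie.
Variable k : fieldType.
Implicit Types X Y Z : finType.

(* Lie(X) is the multilinear part of the free Lie algebra on X: combinations  *)
(* of bracketings in which each x in X occurs once, modulo the relators.      *)
Definition mbracket (X : finType) : Type :=
  {t : bracket X | perm_eq (leaves t) (enum X)}.
HB.instance Definition _ (X : finType) := SubChoice.on (mbracket X).

Definition lie_rel (X : finType) (u : {malg k[mbracket X]}) : Prop :=
  exists2 s : seq (mbracket X), relator (map val s) & u = \sum_(t <- s) << t >>.

Definition lie (X : finType) : Type := lquot (@lie_rel X).
HB.instance Definition _ (X : finType) := GRing.Lmodule.on (lie X).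

Definition lie_br (X : finType) (t : mbracket X) : lie X :=
  lq_pi (@lie_rel X) << t >>.

Fact mbracket_map_subproof (X Y : finType) (f : X -> Y) (t : mbracket X) :
  bijective f -> perm_eq (leaves (bracket_map f (val t))) (enum Y).
Proof.
move=> bf; have inj_f := bij_inj bf; have [g fK gK] := bf.
rewrite leaves_map; apply: perm_trans (perm_map f (valP t)) _.
apply: uniq_perm; rewrite ?enum_uniq ?(map_inj_uniq inj_f) ?enum_uniq // => y.
by rewrite mem_enum -[y]gK map_f ?mem_enum.
Qed.

Definition mbracket_map (X Y : finType) (f : X -> Y) (bf : bijective f)
  (t : mbracket X) : mbracket Y :=
  exist _ (bracket_map f (val t)) (mbracket_map_subproof t bf).

Section LieMap.
Variables (X Y : finType) (f : X -> Y) (bf : bijective f).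

Definition lie_map0 : {malg k[mbracket X]} -> lie Y :=
  malg_lift (fun t => lie_br (mbracket_map bf t)).
HB.instance Definition _ := GRing.Linear.on lie_map0.

Fact lie_map_rel r : @lie_rel X r -> lie_map0 r = 0.
Proof.
case=> s rs ->; rewrite raddf_sum /=.
under eq_bigr do rewrite [lie_map0 _]malg_liftU.
rewrite -raddf_sum -[RHS](raddf0 (lq_pi (@lie_rel Y))); apply/lq_piP.
rewrite subr0; apply: lspan_rel; exists (map (mbracket_map bf) s).
  by rewrite -map_comp (map_comp (bracket_map f)); apply: relator_map.
by rewrite big_map.
Qed.

Definition lie_map : lie X -> lie Y := lq_lift lie_map_rel.
HB.instance Definition _ := GRing.Linear.on lie_map.

Lemma lie_map_br t : lie_map (lie_br t) = lie_br (mbracket_map bf t).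
Proof. by rewrite /lie_map /lie_br lq_lift_pi [LHS]malg_liftU. Qed.
End LieMap.

Lemma lie_sumE X (u : lie X) :
  u = \sum_(t <- msupp (lq_repr u)) (lq_repr u)@_t *: lie_br t.
Proof.
rewrite -[LHS]lq_reprK {1}[lq_repr u]monalgE raddf_sum /=.
by apply: eq_bigr => t _; rewrite malgUE; apply: lq_piZ.
Qed.

Lemma lie_linear_eq X (W : lmodType k) (f g : {linear lie X -> W}) :
  (forall t, f (lie_br t) = g (lie_br t)) -> f =1 g.
Proof.
by move=> e u; rewrite [u]lie_sumE; apply: linear_eq_sum.
Qed.

Fact lie_map_id X (f : X -> X) (bf : bijective f) :
  f =1 id -> lie_map bf =1 id.
Proof.
move=> fid; apply: (lie_linear_eq (f := lie_map bf) (g := idfun)) => t.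
rewrite /= lie_map_br; congr lie_br; apply: val_inj => /=.
by elim: (val t) => /= [x|a -> b ->]; rewrite ?fid.
Qed.

Fact lie_map_comp X Y Z (f : X -> Y) (g : Y -> Z) (h : X -> Z)
    (bf : bijective f) (bg : bijective g) (bh : bijective h) :
  h =1 g \o f -> lie_map bh =1 lie_map bg \o lie_map bf.
Proof.
move=> hE; apply: (lie_linear_eq (f := lie_map bh)
  (g := lie_map bg \o lie_map bf)) => t.
rewrite /= !lie_map_br; congr lie_br; apply: val_inj => /=.
by elim: (val t) => /= [x|a -> b ->]; rewrite ?hE.
Qed.

Definition Lie : smodule k :=
  @SModule k lie (fun X Y f bf => lie_map bf) lie_map_id lie_map_comp.

(* The operad map Lie -> As: the bracket is sent to the commutator, computed  *)
(* in the free associative algebra on X.                                      *)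
Definition free_alg X : nzRingType := {malg k[{fmonom X}]}.

Fixpoint bracket_eval X (t : bracket X) : free_alg X :=
  match t with
  | bvar x => << fmu x >>
  | br a b => bracket_eval a * bracket_eval b - bracket_eval b * bracket_eval a
  end.

Definition lie_as0 (X : finType) : {malg k[mbracket X]} -> As k X :=
  malg_lift (fun t : mbracket X =>
    [ffun w => (bracket_eval (val t))@_(FMonom (word w))] : As k X).
HB.instance Definition _ (X : finType) := GRing.Linear.on (@lie_as0 X).

Lemma bracket_eval_br X (a b : bracket X) :
  bracket_eval (br a b)
  = bracket_eval a * bracket_eval b - bracket_eval b * bracket_eval a.
Proof. by []. Qed.

Fact jacobi_cancel (V : zmodType) (x y z u v w : V) :
  ((x - u) - (z - w)) + ((y - w) - (x - v)) + ((z - v) - (y - u)) = 0.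
Proof.
rewrite !opprB !addrA (ACl (1*8*2*11*3*6*4*9*5*12*7*10)%AC) /=.
by rewrite subrr add0r addNr add0r subrr add0r addNr add0r subrr add0r subrr.
Qed.

Fact anti_cancel (V : zmodType) (T : Type) (f : T -> V) a b x y :
  f a = x - y -> f b = y - x -> \sum_(t <- [:: a; b]) f t = 0.
Proof. by rewrite big_cons big_seq1 => -> ->; rewrite -opprB addNr. Qed.

Fact sum3 (V : zmodType) (T : Type) (f : T -> V) a b c :
  \sum_(t <- [:: a; b; c]) f t = f a + f b + f c.
Proof. by rewrite 2!big_cons big_seq1 addrA. Qed.

Fact jacobi_ring (R : nzRingType) (a b c : R) :
  ((a * b - b * a) * c - c * (a * b - b * a))
  + ((b * c - c * b) * a - a * (b * c - c * b))
  + ((c * a - a * c) * b - b * (c * a - a * c)) = 0.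
Proof. by rewrite !mulrBl !mulrBr !mulrA; apply: jacobi_cancel. Qed.

Fact sum_commr (R : nzRingType) (T : Type) (s : seq T) (f : T -> R) (x : R) :
  \sum_(t <- s) f t = 0 ->
  \sum_(t <- s) (f t * x - x * f t) = 0.
Proof. by move=> e; rewrite sumrB -mulr_suml -mulr_sumr e mul0r mulr0 subrr. Qed.

Fact sum_commrN (R : nzRingType) (T : Type) (s : seq T) (f : T -> R) (x : R) :
  \sum_(t <- s) f t = 0 ->
  \sum_(t <- s) (x * f t - f t * x) = 0.
Proof. by move=> e; rewrite sumrB -mulr_suml -mulr_sumr e mul0r mulr0 subrr. Qed.

Lemma relator_eval (X : finType) (s : seq (bracket X)) :
  relator s -> \sum_(t <- s) bracket_eval t = 0.
Proof.
elim=> [a b|a b c|t {}s _ IH|t {}s _ IH].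
- exact: (anti_cancel (V := free_alg X) (bracket_eval_br a b)
    (bracket_eval_br b a)).
- rewrite (sum3 (V := free_alg X)) !bracket_eval_br.
  exact: (jacobi_ring (R := free_alg X)).
- rewrite big_map.
  exact: (sum_commr (R := free_alg X) (f := @bracket_eval X) _ IH).
rewrite big_map.
exact: (sum_commrN (R := free_alg X) (f := @bracket_eval X) _ IH).
Qed.

Fact lie_as_rel X r : @lie_rel X r -> lie_as0 r = 0.
Proof.
case=> s rs ->; rewrite raddf_sum /=.
under eq_bigr do rewrite [lie_as0 _]malg_liftU.
apply/ffunP => w; rewrite sum_ffunE !ffunE.
under eq_bigr do rewrite ffunE.
by rewrite -raddf_sum -(big_map val xpredT) relator_eval //= mcoeff0.
Qed.

Definition lie_as (X : finType) : lie X -> As k X := lq_lift (@lie_as_rel X).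
HB.instance Definition _ (X : finType) := GRing.Linear.on (@lie_as X).
Lemma lie_as_br X (t : mbracket X) :
  lie_as (lie_br t) = [ffun w => (bracket_eval (val t))@_(FMonom (word w))].
Proof. by rewrite /lie_as /lie_br lq_lift_pi [LHS]malg_liftU. Qed.

Fixpoint bracket_terms (T : Type) (t : bracket T) : seq (k * seq T) :=
  match t with
  | bvar x => [:: (1, [:: x])]
  | br a b =>
      [seq (u.1 * v.1, u.2 ++ v.2) | u <- bracket_terms a, v <- bracket_terms b]
      ++ [seq (- (v.1 * u.1), v.2 ++ u.2)
           | v <- bracket_terms b, u <- bracket_terms a]
  end.

Lemma bracket_evalE X (t : bracket X) :
  bracket_eval t = \sum_(u <- bracket_terms t) << u.1 *g FMonom u.2 >>.
Proof.
elim: t => [x|a IHa b IHb] /=; first by rewrite big_seq1 fmuE.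
have mulE (r s : seq (k * seq X)) :
    (\sum_(u <- r) << u.1 *g FMonom u.2 >> : free_alg X)
      * (\sum_(v <- s) << v.1 *g FMonom v.2 >>)
    = \sum_(u <- r) \sum_(v <- s) << u.1 * v.1 *g FMonom (u.2 ++ v.2) >>.
  rewrite mulr_suml; apply: eq_bigr => u _; rewrite mulr_sumr.
  apply: eq_bigr => v _; rewrite -[FMonom (u.2 ++ v.2)](fmmulE (FMonom u.2) (FMonom v.2)).
  exact: fgmulUU.
rewrite big_cat /= !big_allpairs_dep IHa IHb !mulE -sumrN; congr (_ + _).
by apply: eq_bigr => u _; rewrite -sumrN; apply: eq_bigr => v _;
  rewrite monalgUN.
Qed.

Lemma bracket_terms_map (T U : Type) (f : T -> U) (t : bracket T) :
  bracket_terms (bracket_map f t)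
  = [seq (u.1, map f u.2) | u <- bracket_terms t].
Proof.
elim: t => //= a -> b ->; rewrite map_cat !map_allpairs !allpairs_mapl.
congr (_ ++ _).
  rewrite allpairs_mapr; apply: eq_allpairs => u v /=; by rewrite map_cat.
by rewrite allpairs_mapr; apply: eq_allpairs => u v /=; rewrite map_cat.
Qed.

Lemma bracket_eval_map X Y (f : X -> Y) (t : bracket X) s : injective f ->
  (bracket_eval (bracket_map f t))@_(FMonom (map f s))
  = (bracket_eval t)@_(FMonom s).
Proof.
move=> inj_f; rewrite !bracket_evalE bracket_terms_map big_map !raddf_sum /=.
apply: eq_bigr => u _; rewrite !mcoeffU; congr (_ *+ nat_of_bool _).
by rewrite !fmP (inj_eq (inj_map inj_f)).
Qed.

(* The map Lie -> As commutes with relabelling.                               *)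
Lemma lie_as_map X Y (f : X -> Y) (bf : bijective f) (l : lie X) v w :
  word v = map f (word w) -> lie_as (lie_map bf l) v = lie_as l w.
Proof.
move=> e.
have ev (Z : finType) (z : listing Z) : linear (fun u : As k Z => u z : k^o).
  by move=> c u u'; rewrite !ffunE.
pose evl Z z := HB.pack_for {linear As k Z -> k^o} (fun u : As k Z => u z : k^o)
  (GRing.isLinear.Build _ _ _ _ _ (ev Z z)).
apply: (lie_linear_eq (f := evl Y v \o (@lie_as Y \o lie_map bf))
  (g := evl X w \o @lie_as X)) => t /=.
rewrite lie_map_br !lie_as_br !ffunE e bracket_eval_map //.
exact: bij_inj.
Qed.
End Lie.

(* ------------------------------------------------------------------------- *)

Fact linear_eq3 (k : fieldType) (U W : lmodType k) (f : {linear U -> W}) c x y z :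
  f x = c *: f y + f z -> f (x - (c *: y + z)) = 0.
Proof. by move=> e; rewrite linearB linearP e subrr. Qed.

Fact linear_eq2 (k : fieldType) (U W : lmodType k) (f : {linear U -> W}) x y :
  f x = f y -> f (x - y) = 0.
Proof. by move=> e; rewrite linearB e subrr. Qed.

Section CompositeProduct.
Variables (k : fieldType) (A B : smodule k) (X : finType).

(* A generator a (x) (b_1 (x) ... (x) b_r) of (A o B)(X), with a in A(r) and  *)
(* b_i in B(X_i); the ordered partition X = X_1 + ... + X_r is encoded by the *)
(* map p : X -> 'I_r with fibres X_i.                                         *)
Record sgen := SGen {
  sg_ar : nat;
  sg_pos : (0 < sg_ar)%N;
  sg_part : X -> 'I_sg_ar;
  sg_top : A 'I_sg_ar;
  sg_bot : forall i, B (fib sg_part i) }.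

Notation free := {malg k[{classic sgen}]}.
Definition sfree (g : sgen) : free := << (g : {classic sgen}) >>.

(* Linearity in each tensor factor, and the identification of both actions of *)
(* S_r: renaming the index set along s acts on a and permutes the blocks.     *)
Variant scomp_rel : free -> Prop :=
| scomp_top r r0 p a a' c b :
    scomp_rel (sfree (@SGen r r0 p (c *: a + a') b)
      - (c *: sfree (@SGen r r0 p a b) + sfree (@SGen r r0 p a' b)))
| scomp_bot r r0 p a j c (b b' b'' : forall i, B (fib p i)) :
    b'' j = c *: b j + b' j ->
    (forall i, i != j -> b' i = b i /\ b'' i = b i) ->
    scomp_rel (sfree (@SGen r r0 p a b'')
      - (c *: sfree (@SGen r r0 p a b) + sfree (@SGen r r0 p a b')))
| scomp_sym r r0 p q a b b' (s : 'S_r) (bs : bijective s) :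
    (forall x, q x = s (p x)) ->
    (forall i (h : fib p i -> fib q (s i)) (bh : bijective h),
      (forall x, val (h x) = val x) -> b' (s i) = sm_map B bh (b i)) ->
    scomp_rel (sfree (@SGen r r0 q (sm_map A bs a) b')
      - sfree (@SGen r r0 p a b)).

Definition scomp := lquot scomp_rel.

(* The direct summand A(n) o B of A o B.                                      *)
Definition scomp_arity (n : nat) (z : scomp) : Prop :=
  exists2 u : free, (forall g, g \in msupp u -> sg_ar g = n) &
    z = lq_pi scomp_rel u.
End CompositeProduct.

Arguments sg_bot {k A B X} s i.

Section Zeta.
Variable k : fieldType.

Definition zeta_gen (X : finType) (g : sgen (Com k) (Lie k) X) : As k X :=
  as_comp (com_as (sg_top g)) (fun i => lie_as (sg_bot g i)).

Definition zeta0 (X : finType) :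
    {malg k[{classic sgen (Com k) (Lie k) X}]} -> As k X :=
  malg_lift (fun g : {classic sgen (Com k) (Lie k) X} => zeta_gen g).
HB.instance Definition _ X := GRing.Linear.on (@zeta0 X).

Lemma zeta0_gen X g : zeta0 (sfree g) = @zeta_gen X g.
Proof. exact: malg_liftU. Qed.

Fact as_comp_top (X R : finType) (p : X -> R) c (u u' : As k R)
    (v : forall i, As k (fib p i)) :
  as_comp (c *: u + u') v = c *: as_comp u v + as_comp u' v.
Proof.
rewrite /as_comp scaler_sumr -big_split; apply: eq_bigr => a _ /=.
rewrite scaler_sumr -big_split; apply: eq_bigr => b _ /=.
by rewrite !ffunE scalerA -scalerDl mulrDl -mulrA.
Qed.

Fact as_comp_bot (X R : finType) (p : X -> R) (u : As k R) j c
    (v v' v'' : forall i, As k (fib p i)) :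
  v'' j = c *: v j + v' j ->
  (forall i, i != j -> v' i = v i /\ v'' i = v i) ->
  as_comp u v'' = c *: as_comp u v + as_comp u v'.
Proof.
move=> ej ei; rewrite /as_comp scaler_sumr -big_split; apply: eq_bigr => a _ /=.
rewrite scaler_sumr -big_split; apply: eq_bigr => b _ /=.
rewrite scalerA -scalerDl; congr (_ *: _); rewrite mulrCA -mulrDr; congr (_ * _).
rewrite !(bigD1 j (P := xpredT)) //= ej !ffunE mulrDl -mulrA.
congr (_ * (_ * _) + _ * _); apply: eq_bigr => i /ei [e1 e2].
  by rewrite e2.
by rewrite e1 e2.
Qed.

Section Reindex.
Variables (X : finType) (r : nat) (s : 'S_r) (p q : X -> 'I_r).
Hypothesis qE : forall x, q x = s (p x).

Fact lcast_subproof (P Q : pred X) : P =1 Q ->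
  forall w : listing {x | P x},
    {z : listing {x | Q x} | map val (word z) = map val (word w)}.
Proof.
move=> PQ w; pose c (x : {x | P x}) : {x | Q x} :=
  Sub (val x) (eq_ind _ is_true (valP x) _ (PQ _)).
have inj_c : injective c by move=> x y /(congr1 val) /= /val_inj.
have uc : uniq (map c (word w)) by rewrite map_inj_uniq // word_uniq.
have mc : map c (word w) =i predT.
  move=> y; have Py : P (val y) by rewrite PQ (valP y).
  rewrite inE; apply/mapP; exists (Sub (val y) Py); first exact: mem_word.
  exact: val_inj.
have sc : (0 < size (map c (word w)))%N.
  by rewrite size_map size_word; case/andP: (valP w).
have [z ez] := listingP uc mc sc.
by exists z; rewrite ez -map_comp; apply: eq_map.
Qed.

Definition lcast (P Q : pred X) (PQ : P =1 Q) w := sval (lcast_subproof PQ w).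

Lemma lcastE (P Q : pred X) (PQ : P =1 Q) w :
  map val (word (lcast PQ w)) = map val (word w).
Proof. exact: svalP (lcast_subproof PQ w). Qed.

Lemma vword_inj (P : pred X) (w z : listing {x | P x}) :
  map val (word w) = map val (word z) -> w = z.
Proof. by move/(inj_map val_inj)/word_inj. Qed.

Fact fibE j : (fun x => p x == (s^-1)%g j) =1 (fun x => q x == j).
Proof. by move=> x; rewrite qE -(inj_eq (@perm_inj _ s)) permKV. Qed.

Fact fibE' i : (fun x => q x == s i) =1 (fun x => p x == i).
Proof. by move=> x; rewrite qE (inj_eq (@perm_inj _ s)). Qed.

Definition move_words (b : {dffun forall i, listing (fib p i)}) :
  {dffun forall i, listing (fib q i)} :=
  finfun (fun j => lcast (fibE j) (b ((s^-1)%g j))).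

Definition move_words' (b : {dffun forall i, listing (fib q i)}) :
  {dffun forall i, listing (fib p i)} :=
  finfun (fun i => lcast (fibE' i) (b (s i))).

Lemma words_eq (p' : X -> 'I_r) (b : {dffun forall i, listing (fib p' i)}) i j :
  i = j -> map val (word (b i)) = map val (word (b j)).
Proof. by move=> ->. Qed.

Lemma move_wordsE b i :
  map val (word (move_words b (s i))) = map val (word (b i)).
Proof. by rewrite ffunE lcastE; apply: words_eq; rewrite permK. Qed.

Lemma move_words_bij : bijective move_words.
Proof.
exists move_words' => b; apply/ffunP => i; apply: vword_inj.
  by rewrite ffunE lcastE move_wordsE.
rewrite ffunE lcastE ffunE lcastE; apply: words_eq; exact: permKV.
Qed.

Fact lperm_subproof (a : listing 'I_r) : {a' | word a' = map s (word a)}.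
Proof.
apply: listingP => [|i|]; first by rewrite map_inj_uniq ?word_uniq //;
  apply: perm_inj.
- by rewrite -[i](permKV s) map_f ?mem_word.
by rewrite size_map size_word; case/andP: (valP a).
Qed.

Definition lperm a := sval (lperm_subproof a).

Lemma lpermE a : word (lperm a) = map s (word a).
Proof. exact: svalP (lperm_subproof a). Qed.

Lemma lperm_bij : bijective lperm.
Proof.
apply: injF_bij => a b /(congr1 (@word _)); rewrite !lpermE.
by move/(inj_map (@perm_inj _ s))/word_inj.
Qed.

Lemma as_comp_sym (u u' : As k 'I_r) (v : forall i, As k (fib p i))
    (v' : forall i, As k (fib q i)) :
  (forall a a', word a' = map s (word a) -> u' a' = u a) ->
  (forall i b b', map val (word b') = map val (word b) ->
    v' (s i) b' = v i b) ->
  as_comp u' v' = as_comp u v.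
Proof.
move=> hu hv; rewrite /as_comp (reindex _ (onW_bij _ lperm_bij)).
apply: eq_bigr => a _; rewrite (reindex _ (onW_bij _ move_words_bij)).
apply: eq_bigr => b _; rewrite (hu a _ (lpermE a)).
congr (_ * _ *: mono (flatten _)).
  rewrite (reindex_inj (@perm_inj _ s)); apply: eq_bigr => i _.
  by apply: hv; apply: move_wordsE.
by rewrite lpermE -map_comp; apply: eq_map => i /=; apply: move_wordsE.
Qed.
End Reindex.

Lemma as_symE (X : finType) w : as_sym k X w = (#|X|)`!%:R^-1.
Proof.
rewrite ffunE sum_ffunE (bigD1 w) //= ffunE eqxx big1 ?addr0 => [|v nvw].
  by rewrite /GRing.scale /= mulr1.
by rewrite ffunE (inj_eq (@word_inj X)) eq_sym (negPf nvw).
Qed.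

Lemma com_as_linear (X : finType) : linear (@com_as k X).
Proof.
move=> c u v; rewrite /com_as.
have -> : \sum_e (c *: u + v) e = c * (\sum_e u e) + \sum_e v e :> k.
  by rewrite mulr_sumr -big_split; apply: eq_bigr => e _; rewrite !ffunE.
by rewrite [LHS]scalerDl -scalerA.
Qed.

Fact zeta_rel X r : @scomp_rel k (Com k) (Lie k) X r -> zeta0 r = 0.
Proof.
case=> [n n0 p a a' c b|n n0 p a j c b b' b'' ej ei|n n0 p q a b b' s bs qE bE].
- apply: linear_eq3; rewrite /= !zeta0_gen /zeta_gen /= com_as_linear.
  exact: as_comp_top.
- apply: linear_eq3; rewrite /= !zeta0_gen /zeta_gen /=.
  apply: (@as_comp_bot _ _ _ _ j); first by rewrite ej linearP.
  by move=> i /ei [-> ->].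
apply: linear_eq2; rewrite /= !zeta0_gen /zeta_gen /=.
apply: (as_comp_sym qE) => [w w' _|i w w' e].
  have -> : com_as (sm_map (Com k) bs a) = com_as a.
    by congr (_ *: _); apply: eq_bigr => e _; apply: com_mapE.
  by rewrite /com_as ffunE [RHS]ffunE !as_symE.
pose h (x : fib p i) : fib q (s i) :=
  Sub (val x) (eq_ind_r is_true (valP x) (fibE' qE i (val x))).
have bh : bijective h.
  pose h' (x : fib q (s i)) : fib p i :=
    Sub (val x) (eq_ind _ is_true (valP x) _ (fibE' qE i (val x))).
  by exists h' => x; apply: val_inj.
rewrite (bE i h bh) //; apply: lie_as_map.
by apply: (inj_map val_inj); rewrite e -map_comp; apply: eq_map.
Qed.

Definition zeta (X : finType) : scomp (Com k) (Lie k) X -> As k X :=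
  lq_lift (@zeta_rel X).
HB.instance Definition _ X := GRing.Linear.on (@zeta X).
End Zeta.

(* ------------------------------------------------------------------------- *)

Section Bimodules.
Variable k : fieldType.
Implicit Type M : forall X : finType, {vspace As k X}.

Definition sub_smodule M := forall (X Y : finType) (f : X -> Y),
  bijective f -> forall u, u \in M X -> as_map f u \in M Y.

Definition right_lie_submodule M := sub_smodule M /\
  forall (X : finType) (Y : {set X}) (u : As k (option {x : X | x \notin Y}))
    (l : Lie k {x : X | x \in Y}),
  u \in M _ -> as_pcomp u (lie_as l) \in M X.

Definition left_lie_submodule M := sub_smodule M /\
  forall (X : finType) (Y : {set X}) (l : Lie k (option {x : X | x \notin Y}))
    (u : As k {x : X | x \in Y}),
  u \in M _ -> as_pcomp (lie_as l) u \in M X.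

Definition lie_subbimodule M := right_lie_submodule M /\ left_lie_submodule M.

(* The right Lie-submodule of As generated by an element e of As(Z).          *)
Definition right_lie_generated (Z : finType) (e : As k Z) (X : finType)
    (u : As k X) : Prop :=
  forall M, right_lie_submodule M -> e \in M Z -> u \in M X.
End Bimodules.

(* V is the internal direct sum of the subspaces E n, n >= 1.                 *)
Definition is_direct_sum (k : fieldType) (V : vectType k)
    (E : nat -> {vspace V}) : Prop :=
  (forall N, directv (\sum_(n < N) E n.+1)) /\
  (forall u, exists N, u \in (\sum_(n < N) E n.+1)%VS).

(* Main.v *)
(* Words embed As(X) in the free associative algebra F on X, where sh becomes  *)
(* the Adams operation, that is the unshuffle coproduct followed by the        *)
(* product. Lie elements are primitive, so the Adams operation commutes with   *)
(* every algebra morphism sending variables to Lie elements and with brackets  *)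
(* by Lie elements: sh is a morphism of Lie-bimodules. Since s_n is an         *)
(* eigenvector for 2^n, so is every symmetrised product of n Lie elements.     *)
(*                                                                             *)
(* Reordering two adjacent factors of a product of Lie elements creates a      *)
(* product with one factor less, so by induction the symmetrised products span *)
(* As; the eigenvalues 2^n being distinct, those with n factors span exactly   *)
(* the 2^n-eigenspace, which gives the direct sum and the surjectivity of      *)
(* zeta. They lie in the right Lie-module generated by s_n because a bracket   *)
(* can be substituted one commutator at a time.                                *)
(*                                                                             *)
(* For injectivity, order X. Lie(Y) is spanned by the left-normed brackets     *)
(* [[m, y_1], ..., y_l] with m = min Y, so (Com o Lie)(X) is spanned by        *)
(* unordered families of words starting with their minimum. Sorting the words  *)
(* of such a family by decreasing minimum and concatenating them yields a      *)
(* listing of X that determines the family (cut it at its left-to-right        *)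
(* minima). Hence Com o Lie is a quotient of As, and the surjection            *)
(* As -> Com o Lie -> As of finite-dimensional spaces is injective.            *)

Require Import Defs.
From HB Require Import structures.
From mathcomp Require Import all_boot all_algebra perm.
From mathcomp Require Import finmap monalg.
From mathcomp Require Import boolp.

Set Implicit Arguments.
Unset Strict Implicit.
Unset Printing Implicit Defensive.

Import GRing.Theory.
Local Open Scope ring_scope.

(** * Monoid algebras and the Adams operation *)

(** The multilinear words sit inside the free associative algebra F on X through [tofree], with
    retraction [offree], and the sum over subsets defining [sh] becomes [adams], the coproduct with
    primitive variables followed by the product ([tofree_sh]). On a product of primitive elements
    [adams] is given by a formula using only the algebra structure ([adams_prod]), so it commutes
    with the substitution of Lie elements for letters ([adams_ahom]); it also commutes with the
    bracket by a primitive element ([adams_comm]). Hence eigenspaces are stable under the right and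
    left Lie-actions ([sh_pcomp_lie], [sh_lie_pcomp]).

    Every shuffle fixes s_n, which therefore has eigenvalue 2^n ([sh_sym]), and so does every
    symmetrised product of n brackets ([sh_sym_product]). Swapping neighbours x, y in a product
    costs a product with [x, y] in their place, so by induction on the number of factors the
    symmetrised products span As ([sym_spanT]). In characteristic 0 the 2^n are distinct, hence
    those with n factors span exactly the 2^n-eigenspace ([eigenspace_sym_product]). They are also
    the image of Com(n) o Lie ([zeta_arityP]), and they arise from s_n by inserting one bracket at a
    time ([right_module_composition]).

    So [zeta] is onto. In the other direction, Com o Lie is spanned by unordered families of
    left-normed brackets starting with their minimum, and a listing of X determines such a family;
    this makes Com o Lie a quotient of As ([lspan_word_class]). The composite As -> Com o Lie -> As
    is a surjective endomorphism of a finite-dimensional space, which forces [zeta] to be injective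
    ([zeta_inj]). *)

Lemma malg_ind (k : fieldType) (K : choiceType) (P : {malg k[K]} -> Prop) :
  P 0 -> (forall c t u, P u -> P (c *: << t >> + u)) -> forall u, P u.
Proof.
move=> P0 PD u; rewrite [u]monalgE; elim: (X in P (\sum_(t <- X) _)) => [|t s IH].
  by rewrite big_nil.
by rewrite big_cons malgUE; apply: PD.
Qed.

(* {malg k[K]} is sealed behind this interface, with an opaque instance, so    *)
(* that unification never unfolds its multiplication.                          *)
Record monoid_algebra (k : fieldType) (K : monomType) := MonoidAlgebra {
  ma_sort :> lalgType k;
  ma_bas : K -> ma_sort;
  ma_ext : forall W : lmodType k, (K -> W) -> {linear ma_sort -> W};
  ma_ext_bas : forall (W : lmodType k) (h : K -> W) t, ma_ext h (ma_bas t) = h t;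
  ma_ind : forall P : ma_sort -> Prop,
    P 0 -> (forall c t u, P u -> P (c *: ma_bas t + u)) -> forall u, P u;
  ma_bas1 : ma_bas mone = 1;
  ma_basM : forall s t, ma_bas s * ma_bas t = ma_bas (mmul s t);
  ma_basMZ : forall (c : k) s t,
    ma_bas s * (c *: ma_bas t) = c *: ma_bas (mmul s t) }.

Lemma monoid_algebra_exists (k : fieldType) (K : monomType) : monoid_algebra k K.
Proof.
pose ext (W : lmodType k) (h : K -> W) : {linear {malg k[K]} -> W} :=
  @malg_lift k K W h.
have extU (W : lmodType k) (h : K -> W) t : ext W h << t >> = h t by exact: malg_liftU.
apply: (@MonoidAlgebra k K {malg k[K]} (fun t => << t >>) ext extU (@malg_ind k K)).
- by [].
- by move=> s t; rewrite [LHS]fgmulUU mulr1.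
by move=> c s t; rewrite -!malgUE [LHS]fgmulUU mul1r.
Qed.

Definition malgebra (k : fieldType) (K : monomType) : lalgType k :=
  monoid_algebra_exists k K.

Section Basis.
Variables (k : fieldType) (K : monomType).
Local Notation A := (malgebra k K).

Definition bas : K -> A := ma_bas (monoid_algebra_exists k K).

Lemma bas_ind (P : A -> Prop) :
  P 0 -> (forall c t u, P u -> P (c *: bas t + u)) -> forall u, P u.
Proof. exact: ma_ind. Qed.

Lemma bas_linear_eq (W : lmodType k) (f g : {linear A -> W}) :
  (forall t, f (bas t) = g (bas t)) -> f =1 g.
Proof.
move=> e; elim/bas_ind => [|c t u IH]; first by rewrite !linear0.
by rewrite !linearP /= e IH.
Qed.

Lemma basM (s t : K) : bas s * bas t = bas (mmul s t).
Proof. exact: ma_basM. Qed.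

Lemma basMZ (c : k) (s t : K) : bas s * (c *: bas t) = c *: bas (mmul s t).
Proof. exact: ma_basMZ. Qed.

Lemma bas1 : bas mone = 1.
Proof. exact: ma_bas1. Qed.

Definition lext (W : lmodType k) (h : K -> W) : A -> W :=
  ma_ext (monoid_algebra_exists k K) h.
HB.instance Definition _ (W : lmodType k) (h : K -> W) := GRing.Linear.on (lext h).

Lemma lext_bas (W : lmodType k) (h : K -> W) t : lext h (bas t) = h t.
Proof. exact: ma_ext_bas. Qed.

Definition coef (t : K) : A -> k^o := lext (fun s => (s == t)%:R : k^o).
HB.instance Definition _ t := GRing.Linear.on (coef t).

Lemma coef_bas s t : coef t (bas s) = (s == t)%:R.
Proof. exact: lext_bas. Qed.
End Basis.

Section Mul.
Variables (k : fieldType) (K : monomType).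
Local Notation A := (malgebra k K).

Definition rmul (a g : A) := g * a.
Fact rmul_linear (a : A) : linear (rmul a).
Proof. by move=> c f g; rewrite /rmul mulrDl scalerAl. Qed.
HB.instance Definition _ (a : A) :=
  GRing.isLinear.Build k A A *:%R (rmul a) (rmul_linear a).

(** The sealed interface is only an [lalgType]; the rule for the right factor is extended from
    [basMZ] by linearity. *)
Lemma malgebra_scalerAr (c : k) (f g : A) : f * (c *: g) = c *: (f * g).
Proof.
suff E s : bas k s * (c *: g) = c *: (bas k s * g).
  exact: (@bas_linear_eq k K A (rmul (c *: g)) (c \*: rmul g) E f).
elim/bas_ind: g => [|d t g IH]; first by rewrite mulr0 scaler0 mulr0.
by rewrite scalerDr !mulrDr IH scalerDr scalerA !basMZ scalerA.
Qed.

Definition lmul (a g : A) := a * g.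
Fact lmul_linear (a : A) : linear (lmul a).
Proof. by move=> c f g; rewrite /lmul mulrDr malgebra_scalerAr. Qed.
HB.instance Definition _ (a : A) :=
  GRing.isLinear.Build k A A *:%R (lmul a) (lmul_linear a).

Lemma lmulE a g : lmul a g = a * g. Proof. by []. Qed.
Lemma rmulE a g : rmul a g = g * a. Proof. by []. Qed.
End Mul.

Lemma lext_mul (k : fieldType) (K K' : monomType) (h : K -> malgebra k K') :
  (forall s t, h (mmul s t) = h s * h t) ->
  {morph lext h : f g / f * g}.
Proof.
move=> hM f g.
have E s : lext h \o lmul (bas k s) =1 lmul (h s) \o lext h.
  by apply: bas_linear_eq => t; rewrite /= lmulE basM !lext_bas hM.
suff E1 : lext h \o rmul g =1 rmul (lext h g) \o lext h.
  by have := E1 f; rewrite /= !rmulE.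
apply: bas_linear_eq => s; rewrite /= rmulE lext_bas.
by have := E s g; rewrite /= !lmulE ?rmulE.
Qed.

Section WordPair.
Variable X : choiceType.

(** The monoid algebra of pairs of words, multiplied componentwise, is the tensor square of the free
    algebra and the target of the coproduct. *)
Definition wordpair : Type := ({fmonom X} * {fmonom X})%type.
HB.instance Definition _ := Choice.on wordpair.

Definition wpmul (p q : wordpair) : wordpair := (mmul p.1 q.1, mmul p.2 q.2).
Definition wpone : wordpair := (mone, mone).

Fact wpmulA : associative wpmul.
Proof. by move=> x y z; rewrite /wpmul /= !mulmA. Qed.
Fact wpmul1m : left_id wpone wpmul.
Proof. by case=> x y; rewrite /wpmul /= !mul1m. Qed.
Fact wpmulm1 : right_id wpone wpmul.
Proof. by case=> x y; rewrite /wpmul /= !mulm1. Qed.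
Fact wpmul_unit x y : wpmul x y = wpone -> x = wpone /\ y = wpone.
Proof.
by case: x y => [x x'] [y y'] [/unitm[-> ->] /unitm[-> ->]].
Qed.

HB.instance Definition _ := Choice_isMonomialDef.Build wordpair
  wpmulA wpmul1m wpmulm1 wpmul_unit.
End WordPair.

Section Words.
Variables (k : fieldType) (X : finType).
Local Notation F := (malgebra k {fmonom X}).

Definition mon (s : seq X) : F := bas k (FMonom s).

Lemma mon_linear_eq (W : lmodType k) (f g : {linear F -> W}) :
  (forall s, f (mon s) = g (mon s)) -> f =1 g.
Proof. by move=> e; apply: bas_linear_eq => -[s]; apply: e. Qed.

Lemma mon_nil : mon [::] = 1.
Proof. by rewrite /mon -fmoneE bas1. Qed.

Lemma mon_cat s t : mon (s ++ t) = mon s * mon t.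
Proof. by rewrite /mon basM; congr bas; apply/eqP; rewrite fmP fmM. Qed.

Definition wcoef (s : seq X) : F -> k^o := coef (FMonom s).
HB.instance Definition _ s := GRing.Linear.on (wcoef s).

Lemma wcoef_mon s t : wcoef t (mon s) = (s == t)%:R.
Proof. by rewrite [LHS]coef_bas fmP. Qed.

Lemma mon_prod (I : Type) (r : seq I) (f : I -> seq X) :
  mon (flatten [seq f i | i <- r]) = \prod_(i <- r) mon (f i).
Proof.
elim: r => [|i r IH]; first by rewrite big_nil /= mon_nil.
by rewrite big_cons /= mon_cat IH.
Qed.

Lemma mon_prod1 (s : seq X) : mon s = \prod_(x <- s) mon [:: x].
Proof. by rewrite -mon_prod flatten_seq1. Qed.
End Words.

Section Tensor.
Variables (k : fieldType) (X : finType).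
Local Notation F := (malgebra k {fmonom X}).
Local Notation FF := (malgebra k (wordpair X)).

Definition mon2 (s t : seq X) : FF := bas k ((FMonom s, FMonom t) : wordpair X).

Lemma mon2_linear_eq (W : lmodType k) (f g : {linear FF -> W}) :
  (forall s t, f (mon2 s t) = g (mon2 s t)) -> f =1 g.
Proof. by move=> e; apply: bas_linear_eq => -[[s] [t]]; apply: e. Qed.

Lemma mon2M s t s' t' : mon2 s t * mon2 s' t' = mon2 (s ++ s') (t ++ t').
Proof.
rewrite /mon2 basM; congr bas.
by congr pair; apply/eqP; rewrite fmP fmM.
Qed.

Lemma mon2_nil : mon2 [::] [::] = 1.
Proof. by rewrite /mon2 -fmoneE bas1. Qed.

Definition inL : F -> FF := lext (fun m : {fmonom X} => mon2 m [::]).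
HB.instance Definition _ := GRing.Linear.on inL.
Definition inR : F -> FF := lext (fun m : {fmonom X} => mon2 [::] m).
HB.instance Definition _ := GRing.Linear.on inR.
Definition mult : FF -> F :=
  lext (fun p : wordpair X => mon k (p.1 ++ p.2)).
HB.instance Definition _ := GRing.Linear.on mult.

Lemma inL_mon s : inL (mon k s) = mon2 s [::]. Proof. exact: lext_bas. Qed.
Lemma inR_mon s : inR (mon k s) = mon2 [::] s. Proof. exact: lext_bas. Qed.
Lemma mult_mon2 s t : mult (mon2 s t) = mon k (s ++ t).
Proof. exact: lext_bas. Qed.

Fact inL_is_monoid : monoid_morphism inL.
Proof.
split=> [|f g]; first by rewrite -mon_nil inL_mon mon2_nil.
by apply: lext_mul => s t; rewrite fmM mon2M.
Qed.
HB.instance Definition _ := GRing.isMonoidMorphism.Build F FF inL inL_is_monoid.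

Fact inR_is_monoid : monoid_morphism inR.
Proof.
split=> [|f g]; first by rewrite -mon_nil inR_mon mon2_nil.
by apply: lext_mul => s t; rewrite fmM mon2M.
Qed.
HB.instance Definition _ := GRing.isMonoidMorphism.Build F FF inR inR_is_monoid.
End Tensor.

Section TensorTheory.
Variables (k : fieldType) (X : finType).
Local Notation F := (malgebra k {fmonom X}).
Local Notation FF := (malgebra k (wordpair X)).

Lemma inLR (s t : seq X) : inL (mon k s) * inR (mon k t) = mon2 k s t.
Proof. by rewrite inL_mon inR_mon mon2M cats0. Qed.

Lemma inLRC (f g : F) : inL f * inR g = inR g * inL f.
Proof.
have E s : lmul (inL (mon k s)) \o @inR k X =1 rmul (inL (mon k s)) \o @inR k X.
  apply: mon_linear_eq => t.
  by rewrite /= lmulE rmulE inL_mon inR_mon !mon2M !cats0.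
suff E1 : rmul (inR g) \o @inL k X =1 lmul (inR g) \o @inL k X.
  by have := E1 f; rewrite /= ?lmulE ?rmulE.
by apply: mon_linear_eq => s; have := E s g; rewrite /= !lmulE ?rmulE.
Qed.

Lemma multLR (f g : F) : mult (inL f * inR g) = f * g.
Proof.
have E s : @mult k X \o lmul (inL (mon k s)) \o @inR k X =1 lmul (mon k s).
  by apply: mon_linear_eq => t; rewrite /= lmulE inLR mult_mon2 mon_cat.
suff E1 : @mult k X \o rmul (inR g) \o @inL k X =1 rmul g.
  by have := E1 f; rewrite /= ?lmulE ?rmulE.
by apply: mon_linear_eq => s; have := E s g; rewrite /= !lmulE ?rmulE.
Qed.

Lemma mult_mulL (p : F) (T : FF) : mult (inL p * T) = p * mult T.
Proof.
apply: (mon2_linear_eq (f := @mult k X \o lmul (inL p))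
  (g := lmul p \o @mult k X)) => s t.
by rewrite /= !lmulE -inLR mulrA -rmorphM /= !multLR mulrA.
Qed.

Lemma mult_mulR (p : F) (T : FF) : mult (T * inR p) = mult T * p.
Proof.
apply: (mon2_linear_eq (f := @mult k X \o rmul (inR p))
  (g := rmul p \o @mult k X)) => s t.
by rewrite /= !rmulE -inLR -mulrA -rmorphM /= !multLR mulrA.
Qed.

(** On T = s (x) t both sides are s p t. *)
Lemma mult_mulC (p : F) (T : FF) : mult (T * inL p) = mult (inR p * T).
Proof.
apply: (mon2_linear_eq (f := @mult k X \o rmul (inL p))
  (g := @mult k X \o lmul (inR p))).
move=> s t; rewrite /= rmulE lmulE -inLR -mulrA -inLRC mulrA -rmorphM /=.
by rewrite mulrA -inLRC -mulrA -rmorphM /= !multLR mulrA.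
Qed.
End TensorTheory.

Section AlgHom.
Variables (k : fieldType) (Y : finType) (K : monomType) (v : Y -> malgebra k K).

Definition ahom : malgebra k {fmonom Y} -> malgebra k K :=
  lext (fun m : {fmonom Y} => \prod_(y <- fmonom_val m) v y).
HB.instance Definition _ := GRing.Linear.on ahom.

Lemma ahom_mon (s : seq Y) : ahom (mon k s) = \prod_(y <- s) v y.
Proof. exact: lext_bas. Qed.

Fact ahom_is_monoid : monoid_morphism ahom.
Proof.
split=> [|f g]; first by rewrite -mon_nil ahom_mon big_nil.
by apply: lext_mul => s t; rewrite -big_cat fmM.
Qed.
HB.instance Definition _ := GRing.isMonoidMorphism.Build _ _ ahom ahom_is_monoid.

Lemma ahom_var y : ahom (mon k [:: y]) = v y.
Proof. by rewrite ahom_mon big_seq1. Qed.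
End AlgHom.

Lemma eq_ahom (k : fieldType) (Y : finType) (K : monomType)
  (v v' : Y -> malgebra k K) : v =1 v' -> ahom v =1 ahom v'.
Proof.
move=> e; apply: mon_linear_eq => s; rewrite /= !ahom_mon.
exact: eq_bigr.
Qed.

Lemma ahom_comp (k : fieldType) (Z Y : finType) (K : monomType)
  (v : Y -> malgebra k K) (w : Z -> malgebra k {fmonom Y}) f :
  ahom v (ahom w f) = ahom (fun z => ahom v (w z)) f.
Proof.
suff E : ahom v \o ahom w =1 ahom (fun z => ahom v (w z)) by exact: E.
by apply: mon_linear_eq => s; rewrite /= !ahom_mon rmorph_prod.
Qed.

(** For a + b and c + d the coproducts of two primitive elements, the mixed terms cancel; hence
    commutators of primitives are primitive. *)
Lemma commutatorD (R : pzRingType) (a b c d : R) : a * d = d * a -> b * c = c * b ->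
  (a + b) * (c + d) - (c + d) * (a + b) = (a * c - c * a) + (b * d - d * b).
Proof.
move=> ead ebc; rewrite !mulrDl !mulrDr ead ebc.
rewrite (AC (2*2) ((2*3)*(1*4))) /= [X in _ - X](AC (2*2) ((3*2)*(1*4))) /=.
by rewrite opprD [LHS]addrACA subrr add0r opprD addrACA.
Qed.

Section Adams.
Variables (k : fieldType) (X : finType).
Local Notation F := (malgebra k {fmonom X}).
Local Notation FF := (malgebra k (wordpair X)).

(* The unshuffle coproduct, for which the variables are primitive.            *)
Definition coprod : F -> FF :=
  ahom (fun x => inL (mon k [:: x]) + inR (mon k [:: x])).
HB.instance Definition _ := GRing.Linear.on coprod.
HB.instance Definition _ := GRing.RMorphism.on coprod.

Definition adams : F -> F := @mult k X \o coprod.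
HB.instance Definition _ := GRing.Linear.on adams.

Definition primitive (p : F) := coprod p = inL p + inR p.

Lemma primitive_var x : primitive (mon k [:: x]).
Proof. exact: ahom_var. Qed.

Lemma primitive_comm p q :
  primitive p -> primitive q -> primitive (p * q - q * p).
Proof.
move=> ep eq; rewrite /primitive !rmorphB /= !rmorphM /= ep eq.
by rewrite commutatorD // -?inLRC.
Qed.

(** [adams] is not multiplicative, but when the coproduct of y is multiplied by p (x) 1 + 1 (x) p on
    either side, the two terms with p in the middle agree by [mult_mulC] and cancel. *)
Lemma adams_comm (p y : F) : primitive p ->
  adams (y * p - p * y) = adams y * p - p * adams y.
Proof.
move=> pp; rewrite /adams /= rmorphB !rmorphM /= pp mulrDl mulrDr.
rewrite !linearB !linearD /= mult_mulL mult_mulR mult_mulC.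
by rewrite [X in _ + X = _]addrC addrACA subrr add0r.
Qed.

(* The coproduct of the product is the product of the v_i (x) 1 + 1 (x) v_i.   *)
Lemma adams_prod n (v : 'I_n -> F) : (forall i, primitive (v i)) ->
  adams (\prod_i v i) = \sum_(A : {set 'I_n})
    (\prod_(i <- enum A) v i) * (\prod_(i <- enum (~: A)) v i).
Proof.
move=> pv; rewrite /adams /= rmorph_prod /=.
under eq_bigr do rewrite pv.
rewrite bigA_distr linear_sum /=; apply: eq_bigr => A _.
have S (s : seq 'I_n) :
    \prod_(i <- s) (if i \in A then inL (v i) else inR (v i)) =
    inL (\prod_(i <- s | i \in A) v i) * inR (\prod_(i <- s | i \notin A) v i).
  elim: s => [|i s IH]; first by rewrite !big_nil !rmorph1 mulr1.
  rewrite !big_cons; case: ifP => _ /=; rewrite IH rmorphM /= !mulrA //.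
  by rewrite -inLRC.
have enumE (B : {set 'I_n}) : \prod_(i <- enum B) v i = \prod_(i | i \in B) v i.
  by rewrite -deprecated_filter_index_enum big_filter.
rewrite S multLR !enumE; congr (_ * _).
by apply: eq_bigl => i; rewrite inE.
Qed.
End Adams.

(** [adams_prod] applies both to a product of variables and to the product of their primitive
    images, and an algebra morphism carries one formula to the other. *)
Lemma adams_ahom (k : fieldType) (Y X : finType)
    (v : Y -> malgebra k {fmonom X}) : (forall y, primitive (v y)) ->
  forall f, adams (ahom v f) = ahom v (adams f).
Proof.
move=> pv f; suff E : @adams k X \o ahom v =1 ahom v \o @adams k Y by exact: E.
apply: mon_linear_eq => s /=.
have -> : mon k s = \prod_(i < size s) mon k [:: tnth (in_tuple s) i].
  by rewrite mon_prod1 (big_tnth _ _ s xpredT).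
rewrite rmorph_prod /= !adams_prod; first last.
- by move=> i; rewrite ahom_var.
- by move=> i; apply: primitive_var.
by rewrite linear_sum; apply: eq_bigr => A _ /=; rewrite rmorphM !rmorph_prod.
Qed.

Section BracketEval.
Variables (k : fieldType) (X : finType).
Local Notation F := (malgebra k {fmonom X}).

(** [bracket_eval] redone in the sealed algebra; [wcoef_bev] identifies the coefficients. *)
Fixpoint bev (t : bracket X) : F :=
  match t with
  | bvar x => mon k [:: x]
  | br a b => bev a * bev b - bev b * bev a
  end.

Lemma primitive_bev t : primitive (bev t).
Proof.
elim: t => [x|a IHa b IHb] /=; first exact: primitive_var.
exact: primitive_comm.
Qed.

Lemma bev_terms t : bev t = \sum_(u <- bracket_terms k t) u.1 *: mon k u.2.
Proof.
elim: t => [x|a IHa b IHb] /=; first by rewrite big_seq1 scale1r.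
have mulE (r s : seq (k * seq X)) :
    (\sum_(u <- r) u.1 *: mon k u.2) * (\sum_(v <- s) v.1 *: mon k v.2)
    = \sum_(u <- r) \sum_(v <- s) (u.1 * v.1) *: mon k (u.2 ++ v.2).
  rewrite mulr_suml; apply: eq_bigr => u _; rewrite mulr_sumr.
  apply: eq_bigr => v _; rewrite mon_cat -scalerAl.
  by rewrite malgebra_scalerAr scalerA.
rewrite big_cat /= !big_allpairs_dep IHa IHb !mulE -sumrN; congr (_ + _).
by apply: eq_bigr => u _; rewrite -sumrN; apply: eq_bigr => v _; rewrite scaleNr.
Qed.

Lemma wcoef_bev t s : wcoef s (bev t) = (bracket_eval k t)@_(FMonom s).
Proof.
rewrite bev_terms bracket_evalE !raddf_sum /=; apply: eq_bigr => u _.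
by rewrite linearZ /= wcoef_mon mcoeffU fmP; apply: mulr_natr.
Qed.
End BracketEval.

Lemma bev_map (k : fieldType) (Y X : finType) (f : Y -> X) t :
  bev k (bracket_map f t) = ahom (fun y => mon k [:: f y]) (bev k t).
Proof.
elim: t => [x|a IHa b IHb] /=; first by rewrite ahom_var.
by rewrite IHa IHb rmorphB !rmorphM.
Qed.

(** * Multilinear maps and listings *)

Lemma lspanD (k : fieldType) (W : lmodType k) (S : W -> Prop) u v :
  lspan S u -> lspan S v -> lspan S (u + v).
Proof. by move=> su sv; rewrite -[u]scale1r; apply: lspanZD. Qed.

Lemma lspanZ (k : fieldType) (W : lmodType k) (S : W -> Prop) c u :
  lspan S u -> lspan S (c *: u).
Proof. by move=> su; rewrite -[_ *: _]addr0; apply: lspanZD => //; constructor. Qed.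

Lemma lspanN (k : fieldType) (W : lmodType k) (S : W -> Prop) u :
  lspan S u -> lspan S (- u).
Proof. by rewrite -scaleN1r; apply: lspanZ. Qed.

Lemma lspan_bind (k : fieldType) (U V : lmodType k) (f : {linear U -> V})
    (S : U -> Prop) (T : V -> Prop) u :
  (forall r, S r -> lspan T (f r)) -> lspan S u -> lspan T (f u).
Proof.
move=> ST; elim=> [|c r v Sr _ IH]; first by rewrite linear0; constructor.
by rewrite linearP; apply: lspanZD => //; apply: ST.
Qed.

Lemma lspan_trans (k : fieldType) (V : lmodType k) (S T : V -> Prop) u :
  (forall r, S r -> lspan T r) -> lspan S u -> lspan T u.
Proof. exact: (@lspan_bind k V V idfun). Qed.

Lemma lspan_sum (k : fieldType) (V : lmodType k) (S : V -> Prop)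
    (T : Type) (r : seq T) (c : T -> k) (h : T -> V) :
  (forall t, S (h t)) -> lspan S (\sum_(t <- r) c t *: h t).
Proof.
move=> Sh; elim: r => [|t r IH]; first by rewrite big_nil; constructor.
by rewrite big_cons; constructor.
Qed.

Section MultilinearMaps.
Variables (k : fieldType) (I : finType) (B : I -> lmodType k) (W : lmodType k).

(** The hypotheses on b, b', b'' copy those of [scomp_bot], so that the notion fits the generators
    of Com o Lie directly. *)
Definition multilinear (Phi : (forall i, B i) -> W) :=
  forall j c (b b' b'' : forall i, B i), b'' j = c *: b j + b' j ->
  (forall i, i != j -> b' i = b i /\ b'' i = b i) ->
  Phi b'' = c *: Phi b + Phi b'.

Lemma multilinear_span (Phi : (forall i, B i) -> W) (S : forall i, B i -> Prop)
    (U : W -> Prop) : multilinear Phi ->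
  (forall i x, lspan (S i) x) -> U 0 ->
  (forall c u v, U u -> U v -> U (c *: u + v)) ->
  (forall b, (forall i, S i (b i)) -> U (Phi b)) -> forall b, U (Phi b).
Proof.
move=> lin span U0 UD US b0.
(* [l] lists the indices whose factor has not yet been expanded in the spanning set. *)
suff K (l : seq I) b : (forall i, i \notin l -> S i (b i)) -> U (Phi b).
  by apply: (K (enum I) b0) => i; rewrite mem_enum.
elim: l b => [|j l IH] b Sb; first by apply: US => i; apply: Sb.
  have dE (x : B j) i : i != j -> dfwith b x i = b i.
    by move=> nij; rewrite dfwith_out // eq_sym.
  have bE : dfwith b (b j) = b.
    by apply: functional_extensionality_dep => i; case: dfwithP.
  rewrite -bE; elim: (span j (b j)) => [|c r x Sr _ IHx].
    (* Factor j is 0: linearity with c = 1 on three equal families reads Phi = Phi + Phi. *)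
    have := lin j 1 (dfwith b (0 : B j)) (dfwith b (0 : B j)) (dfwith b (0 : B j)).
    rewrite !dfwith_in scaler0 addr0 scale1r => /(_ erefl) e.
    suff -> : Phi (dfwith b (0 : B j)) = 0 by [].
    by apply/(addrI (Phi (dfwith b (0 : B j)))); rewrite -e ?addr0 // => i /dE ->.
  rewrite (lin j c (dfwith b r) (dfwith b x)); first last.
  - by move=> i nij; rewrite !dE.
  - by rewrite !dfwith_in.
  apply: UD => //; apply: IH => i nil; have [eij|nij] := eqVneq i j.
    by rewrite eij dfwith_in.
  by rewrite dE //; apply: Sb; rewrite inE negb_or nij.
Qed.
End MultilinearMaps.

HB.lock Definition tofree (k : fieldType) (X : finType) (u : As k X) :
  malgebra k {fmonom X} := as_lift (fun w => mon k (word w)) u.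

Section ListingBasis.
Variables (k : fieldType) (X : finType).
Local Notation F := (malgebra k {fmonom X}).

Lemma as_sumE (u : As k X) : u = \sum_w (u w : k) *: mono (word w).
Proof.
apply/ffunP => w; rewrite sum_ffunE (bigD1 w) //= big1 => [|v nvw].
  by rewrite !ffunE eqxx addr0 [RHS]mulr1.
by rewrite !ffunE (inj_eq (@word_inj X)) eq_sym (negPf nvw) scaler0.
Qed.

Lemma as_linear_eq (W : lmodType k) (f g : {linear As k X -> W}) :
  (forall w, f (mono (word w)) = g (mono (word w))) -> f =1 g.
Proof. by move=> e u; rewrite [u]as_sumE; apply: linear_eq_sum. Qed.

Lemma lspan_as (u : As k X) : lspan (fun v => exists w, v = mono (word w)) u.
Proof. by rewrite [u]as_sumE; apply: lspan_sum => w; exists w. Qed.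

Fact tofree_linear : linear (@tofree k X).
Proof. by rewrite tofree.unlock; apply: as_lift_linear. Qed.
HB.instance Definition _ :=
  GRing.isLinear.Build k (As k X) F *:%R (@tofree k X) tofree_linear.

Lemma tofree_word (w : listing X) : tofree (mono (word w)) = mon k (word w).
Proof. by rewrite tofree.unlock as_lift_mono. Qed.

(** The projection onto the multilinear part, which kills every word that is not a listing. *)
Definition offree (f : F) : As k X := [ffun w => wcoef (word w) f].

Fact offree_linear : linear offree.
Proof. by move=> c f g; apply/ffunP => w; rewrite !ffunE linearP. Qed.
HB.instance Definition _ := GRing.isLinear.Build k F (As k X) *:%R offree offree_linear.

Lemma offree_mon s : offree (mon k s) = mono s.
Proof. by apply/ffunP => w; rewrite !ffunE wcoef_mon eq_sym. Qed.

Lemma tofreeK : cancel (@tofree k X) offree.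
Proof.
suff E : offree \o @tofree k X =1 idfun by exact: E.
by apply: as_linear_eq => w; rewrite /= tofree_word offree_mon.
Qed.

Definition is_listing (s : seq X) := perm_eq s (enum X) && (0 < size s)%N.

Lemma is_listingP s : reflect (exists w, word w = s) (is_listing s).
Proof.
apply: (iffP andP) => [[ps s0]|[w <-]].
  have [|x|//|w ew] := @listingP X s; last by exists w.
    by rewrite (perm_uniq ps) enum_uniq.
  by rewrite (perm_mem ps) mem_enum.
split; last by rewrite size_word; case/andP: (valP w).
apply: uniq_perm; rewrite ?word_uniq ?enum_uniq // => x.
by rewrite mem_word mem_enum.
Qed.

Lemma mono_notlisting s : ~~ is_listing s -> mono s = 0 :> As k X.
Proof.
move=> ns; apply/ffunP => w; rewrite !ffunE; case: eqP => // e.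
by case/is_listingP: ns; exists w.
Qed.

Lemma tofree_mono s : is_listing s -> tofree (mono s) = mon k s.
Proof. by case/is_listingP => w <-; apply: tofree_word. Qed.

Definition shuf n (A : {set 'I_n}) (t : n.-tuple X) : seq X :=
  [seq tnth t i | i <- enum A ++ enum (~: A)].

Lemma enum_setC_perm n (A : {set 'I_n}) : perm_eq (enum A ++ enum (~: A)) (enum 'I_n).
Proof.
apply: uniq_perm; rewrite ?enum_uniq //.
  rewrite cat_uniq !enum_uniq andbT /=; apply/hasPn => x.
  by rewrite !mem_enum inE.
by move=> x; rewrite mem_cat !mem_enum inE orbN.
Qed.

Lemma shuf_perm n (A : {set 'I_n}) (t : n.-tuple X) : perm_eq (shuf A t) t.
Proof.
by rewrite -[X in perm_eq _ X](map_tnth_enum t) perm_map // enum_setC_perm.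
Qed.

Lemma is_listing_shuf n (A : {set 'I_n}) (t : n.-tuple X) :
  is_listing (shuf A t) = is_listing t.
Proof.
rewrite /is_listing (perm_size (shuf_perm A t)).
by rewrite (permPl (shuf_perm A t)).
Qed.

Lemma map_sigma n (A : {set 'I_n}) :
  map (sigma A) (enum 'I_n) = enum A ++ enum (~: A).
Proof.
have sE := perm_size (enum_setC_perm A); rewrite size_enum_ord in sE.
case: n A sE => [|n] A sE; first by rewrite (size0nil sE) enum_ord0.
apply: (@eq_from_nth _ ord0) => [|i]; rewrite size_map size_enum_ord ?sE // => lt_in.
rewrite (nth_map ord0) ?size_enum_ord // permE /sigma_fun.
rewrite nth_enum_ord // (set_nth_default ord0) ?sE ?nth_enum_ord //.
Qed.

Lemma left_mul_sigma (A : {set 'I_#|X|}) w : left_mul (sigma A) w = shuf A (val w).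
Proof. by rewrite /shuf -map_sigma -map_comp. Qed.

Lemma adams_mon n (t : n.-tuple X) :
  adams (mon k t) = \sum_(A : {set 'I_n}) mon k (shuf A t).
Proof.
rewrite mon_prod1 big_tuple adams_prod; last by move=> i; apply: primitive_var.
apply: eq_bigr => A _; rewrite -big_cat /shuf -mon_prod.
by rewrite flatten_map1.
Qed.
End ListingBasis.

(** * Shuffles and operadic compositions in the free algebra *)

Section ShuffleAdams.
Variables (k : fieldType) (X : finType).

Lemma sh_word (w : listing X) :
  sh k X (mono (word w)) = \sum_(A : {set 'I_#|X|}) mono (shuf A (val w)).
Proof.
by rewrite lfunE /= as_lift_mono; apply: eq_bigr => A _; rewrite left_mul_sigma.
Qed.

Lemma tofree_sh (u : As k X) : tofree (sh k X u) = adams (tofree u).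
Proof.
suff E : @tofree k X \o sh k X =1 @adams k X \o @tofree k X by exact: E.
apply: as_linear_eq => w /=; rewrite sh_word linear_sum tofree_word adams_mon.
apply: eq_bigr => A _; apply: tofree_mono; rewrite is_listing_shuf.
by apply/is_listingP; exists w.
Qed.

(** A shuffle of a word is a listing exactly when the word is, so [adams] respects the
    projection. *)
Lemma sh_offree f : sh k X (offree f) = offree (adams f).
Proof.
suff E : sh k X \o @offree k X =1 @offree k X \o @adams k X by exact: E.
apply: mon_linear_eq => s; apply: (can_inj (@tofreeK k X)) => /=.
have aE := adams_mon k (in_tuple s); rewrite /= in aE.
rewrite tofree_sh aE !linear_sum /= offree_mon.
case ls : (is_listing s).
  rewrite tofree_mono // aE; apply: eq_bigr => A _.
  by rewrite offree_mon tofree_mono // is_listing_shuf.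
rewrite mono_notlisting ?ls // !linear0 big1 // => A _.
by rewrite offree_mon mono_notlisting ?linear0 // is_listing_shuf ls.
Qed.
End ShuffleAdams.

Section Relabel.
Variables (k : fieldType) (Y X : finType) (f : Y -> X).

Definition relab : malgebra k {fmonom Y} -> malgebra k {fmonom X} :=
  ahom (fun y => mon k [:: f y]).
HB.instance Definition _ := GRing.Linear.on relab.
HB.instance Definition _ := GRing.RMorphism.on relab.

Lemma relab_mon s : relab (mon k s) = mon k (map f s).
Proof. by rewrite [LHS]ahom_mon -mon_prod flatten_map1. Qed.

Lemma as_mapE (u : As k Y) : as_map f u = offree (relab (tofree u)).
Proof.
suff E : @as_map k Y X f =1 @offree k X \o relab \o @tofree k Y by exact: E.
apply: as_linear_eq => w.
by rewrite /= [LHS]as_lift_mono tofree_word relab_mon offree_mon.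
Qed.
End Relabel.

Section PartialComposition.
Variables (k : fieldType) (X : finType) (Y : {set X}).
Local Notation outer := (option {x : X | x \notin Y}).
Local Notation inner := {x : X | x \in Y}.

Definition pcomp_var (v : malgebra k {fmonom inner}) (o : outer) :
    malgebra k {fmonom X} :=
  if o is Some x then mon k [:: val x] else relab val v.

Lemma ahom_pcomp_var_mon a b :
  ahom (pcomp_var (mon k b)) (mon k a) = mon k (word_subst a b).
Proof.
rewrite ahom_mon mon_prod; apply: eq_bigr => -[x|] _ //=.
exact: relab_mon.
Qed.

(** The letter [None] occurs once in [a], which makes the substitution linear in what replaces
    it. *)
Lemma pcomp_var_factor (a : seq outer) : uniq a -> None \in a ->
  exists P Q, forall f, ahom (pcomp_var f) (mon k a) = P * relab val f * Q.
Proof.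
move=> ua /splitPr sa; case: sa ua => s t; rewrite cat_uniq /= negb_or.
case/and3P=> _ /andP[ns _] /andP[nt _].
have E f (r : seq outer) : None \notin r ->
    \prod_(o <- r) pcomp_var f o = \prod_(o <- r) pcomp_var 0 o.
  move=> nr; apply: eq_big_seq => -[x|] //; by rewrite (negPf nr).
exists (\prod_(o <- s) pcomp_var 0 o), (\prod_(o <- t) pcomp_var 0 o) => f.
by rewrite ahom_mon big_cat big_cons /= mulrA !(E f).
Qed.

(** Operadic composition becomes an algebra morphism, to which [adams_ahom] applies; by bilinearity
    it is enough to compare words. *)
Lemma as_pcompE (u : As k outer) (v : As k inner) :
  as_pcomp u v = offree (ahom (pcomp_var (tofree v)) (tofree u)).
Proof.
rewrite [in RHS](as_sumE u) !linear_sum; apply: eq_bigr => a _ /=.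
rewrite !linearZ /= tofree_word.
have [P [Q PQ]] := pcomp_var_factor (word_uniq a) (mem_word a None).
pose L : {linear malgebra k {fmonom inner} -> malgebra k {fmonom X}} :=
  lmul P \o rmul Q \o @relab k inner X val.
have LE f : ahom (pcomp_var f) (mon k (word a)) = L f.
  by rewrite PQ -mulrA /= lmulE rmulE.
rewrite LE [in RHS](as_sumE v) (linear_sum (@tofree k inner)) (linear_sum L).
rewrite (linear_sum (@offree k X)) scaler_sumr; apply: eq_bigr => b _.
rewrite linearZZ [L _]linearZZ linearZZ scalerA.
by rewrite [X in L X](tofree_word k b) -LE ahom_pcomp_var_mon /= offree_mon.
Qed.
End PartialComposition.

Section FullComposition.
Variables (k : fieldType) (X R : finType) (p : X -> R).

Definition comp_var (v : forall i, As k (fib p i)) (i : R) :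
  malgebra k {fmonom X} := relab val (tofree (v i)).

Lemma ahom_comp_var_multilinear (f : As k R) :
  multilinear (fun v => offree (ahom (comp_var v) (tofree f))).
Proof.
move=> j c v v' v'' ej ei; rewrite /= (as_sumE f) !linear_sum /=. rewrite -big_split.
apply: eq_bigr => a _ /=.
suff E : ahom (comp_var v'') (mon k (word a)) =
    c *: ahom (comp_var v) (mon k (word a)) + ahom (comp_var v') (mon k (word a)).
  by rewrite !linearZ /= tofree_word E linearP scalerDr.
rewrite !ahom_mon.
have /splitPr sa := mem_word a j; have := word_uniq a; case: sa => s t.
rewrite cat_uniq /= negb_or => /and3P[_ /andP[ns _] /andP[nt _]].
have E (r : seq R) : j \notin r ->
    \prod_(i <- r) comp_var v' i = \prod_(i <- r) comp_var v i /\
    \prod_(i <- r) comp_var v'' i = \prod_(i <- r) comp_var v i.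
  move=> nr; split; apply: eq_big_seq => i ir; rewrite /comp_var.
    by rewrite (ei i _).1 //; apply: contraNneq nr => <-.
  by rewrite (ei i _).2 //; apply: contraNneq nr => <-.
rewrite !big_cat !big_cons /= !(E s ns).1 !(E s ns).2 !(E t nt).1 !(E t nt).2.
rewrite {2}/comp_var ej !linearP /= mulrDl mulrDr -scalerAl.
by rewrite malgebra_scalerAr.
Qed.

(** Both sides are multilinear in v, so each v i may be a single word; then one choice of words
    survives in the sum defining [as_comp]. *)
Lemma as_compE (u : As k R) (v : forall i, As k (fib p i)) :
  as_comp u v = offree (ahom (comp_var v) (tofree u)).
Proof.
apply/eqP; rewrite -subr_eq0; apply/eqP.
apply: (@multilinear_span k R (fun i => As k (fib p i)) (As k X)
  (fun v => as_comp u v - offree (ahom (comp_var v) (tofree u)))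
  (fun i x => exists w, x = mono (word w)) (fun x => x = 0)) => //.
- move=> j c b b' b'' ej ei; rewrite (as_comp_bot _ ej ei).
  rewrite (ahom_comp_var_multilinear u ej ei).
  by rewrite scalerBr opprD addrACA.
- by move=> i x; apply: lspan_as.
- by move=> c x y -> ->; rewrite scaler0 addr0.
move=> b Sb; apply/eqP; rewrite subr_eq0; apply/eqP.
pose b0 : {dffun forall i, listing (fib p i)} := finfun (fun i => projT1 (cid (Sb i))).
have bE i : b i = mono (word (b0 i)) by rewrite ffunE; case: (cid (Sb i)).
rewrite [in RHS](as_sumE u) !linear_sum; apply: eq_bigr => a _ /=.
rewrite (bigD1 b0) //= [X in _ + X = _]big1 ?addr0 => [|c nc]; last first.
  have [i nci] : exists i, c i != b0 i.
    by apply/existsP; apply: contraR nc; rewrite negb_exists => /forallP e;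
      apply/eqP/ffunP => i; apply/eqP; move: (e i); rewrite negbK.
  rewrite (bigD1 i) //= bE ffunE (inj_eq (@word_inj _)) (negPf nci) mul0r mulr0.
  by rewrite scale0r.
rewrite big1 ?mulr1 => [|i _]; last by rewrite bE ffunE eqxx.
rewrite !linearZ /= tofree_word ahom_mon; congr (_ *: _).
rewrite -offree_mon mon_prod; congr offree; apply: eq_bigr => i _.
by rewrite /comp_var bE tofree_word relab_mon.
Qed.
End FullComposition.

(** * Lie elements and eigenspaces *)

Section Homogeneous.
Variables (k : fieldType) (X : finType).
Local Notation F := (malgebra k {fmonom X}).

Definition homog (s : seq X) : F -> Prop :=
  lspan (fun m => exists2 w, perm_eq w s & m = mon k w).

Lemma homog_mon s w : perm_eq w s -> homog s (mon k w).
Proof. by move=> ps; apply: lspan_rel; exists w. Qed.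

Lemma homog_perm s t f : perm_eq s t -> homog s f -> homog t f.
Proof.
move=> pst; apply: lspan_trans => _ [w pw ->]; apply: homog_mon.
exact: perm_trans pw pst.
Qed.

Lemma homogM s t f g : homog s f -> homog t g -> homog (s ++ t) (f * g).
Proof.
move=> hf hg; rewrite -rmulE; apply: lspan_bind hf => _ [w pw ->].
rewrite /= rmulE -lmulE; apply: lspan_bind hg => _ [w' pw' ->].
by rewrite /= lmulE -mon_cat; apply: homog_mon; apply: perm_cat.
Qed.

Lemma homog_prod (I : Type) (r : seq I) (d : I -> seq X) (v : I -> F) :
  (forall i, homog (d i) (v i)) ->
  homog (flatten [seq d i | i <- r]) (\prod_(i <- r) v i).
Proof.
move=> hv; elim: r => [|i r IH]; rewrite ?big_nil ?big_cons /=.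
  by rewrite -mon_nil; apply: homog_mon.
exact: homogM.
Qed.

Lemma homog_bev t : homog (leaves t) (bev k t).
Proof.
elim: t => [x|a IHa b IHb] /=; first exact: homog_mon.
rewrite addrC -scaleN1r; apply: lspanZD; last exact: homogM.
by apply: homog_perm (homogM IHb IHa); rewrite perm_catC.
Qed.

Lemma homog_tofree (u : As k X) : homog (enum X) (tofree u).
Proof.
apply: lspan_bind (lspan_as u) => _ [w ->] /=; rewrite tofree_word.
apply: homog_mon; apply: uniq_perm; rewrite ?word_uniq ?enum_uniq // => x.
by rewrite mem_word mem_enum.
Qed.

(** For X empty this would fail: the empty word has multidegree [enum X] but is no listing. *)
Lemma homog_offreeK f : (0 < #|X|)%N -> homog (enum X) f -> tofree (offree f) = f.
Proof.
move=> X0; elim=> [|c _ g [w pw ->] _ IH]; first by rewrite !linear0.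
rewrite !linearP /= IH offree_mon tofree_mono //.
by rewrite /is_listing pw (perm_size pw) -cardE.
Qed.
End Homogeneous.

Lemma homog_ahom (k : fieldType) (Y X : finType) (v : Y -> malgebra k {fmonom X})
    (d : Y -> seq X) s f :
  (forall y, homog (d y) (v y)) -> homog s f ->
  homog (flatten [seq d y | y <- s]) (ahom v f).
Proof.
move=> hv; apply: lspan_bind => _ [w pw ->] /=; rewrite ahom_mon.
apply: homog_perm (homog_prod w hv).
by apply: perm_flatten; apply: perm_map.
Qed.

Section LieElements.
Variables (k : fieldType) (X : finType).

Lemma lie_as_bev (t : mbracket X) : lie_as (lie_br k t) = offree (bev k (val t)).
Proof. by rewrite lie_as_br; apply/ffunP => w; rewrite !ffunE wcoef_bev. Qed.

Lemma leaves_gt0 (T : Type) (t : bracket T) : (0 < size (leaves t))%N.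
Proof. by elim: t => //= a IHa b _; rewrite size_cat addn_gt0 IHa. Qed.

Lemma tofree_lie_br (t : mbracket X) : tofree (lie_as (lie_br k t)) = bev k (val t).
Proof.
have pt := valP t; rewrite lie_as_bev homog_offreeK //.
  by rewrite cardE -(perm_size pt) leaves_gt0.
exact: homog_perm pt (homog_bev k _).
Qed.

Lemma primitive_relab_lie (Z : finType) (f : X -> Z) (l : lie k X) :
  primitive (relab f (tofree (lie_as l))).
Proof.
pose g := relab f \o @tofree k X \o @lie_as k X.
suff E : @coprod k Z \o g =1 (@inL k Z \o g) \+ (@inR k Z \o g) by exact: E.
apply: lie_linear_eq => t; rewrite /g /= tofree_lie_br /relab -bev_map.
exact: primitive_bev.
Qed.

Lemma lspan_lie (l : lie k X) : lspan (fun r => exists t, r = lie_br k t) l.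
Proof. by rewrite [l]lie_sumE; apply: lspan_sum => t; exists t. Qed.
End LieElements.

Section Eigenspaces.
Variable k : fieldType.

Lemma sh_eigenspaceP n (X : finType) (u : As k X) :
  reflect (sh k X u = 2%:R ^+ n *: u) (u \in sh_eigenspace k n X).
Proof.
rewrite /sh_eigenspace /passmx.leigenspace memv_ker.
by rewrite add_lfunE opp_lfunE scale_lfunE id_lfunE subr_eq0; apply: eqP.
Qed.

Lemma sh_as_map (X Y : finType) (f : X -> Y) (u : As k X) :
  sh k Y (as_map f u) = as_map f (sh k X u).
Proof.
rewrite !as_mapE sh_offree tofree_sh adams_ahom // => x.
exact: primitive_var.
Qed.

Lemma sh_pcomp_lie (X : finType) (Y : {set X})
    (u : As k (option {x : X | x \notin Y})) (l : lie k {x : X | x \in Y}) :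
  sh k X (as_pcomp u (lie_as l)) = as_pcomp (sh k _ u) (lie_as l).
Proof.
rewrite !as_pcompE sh_offree tofree_sh adams_ahom // => -[x|] /=.
  exact: primitive_var.
exact: primitive_relab_lie.
Qed.

(** At each node on the path to the single leaf [None], an eigenvector is bracketed with a primitive
    element, and [adams_comm] preserves the eigenvalue. *)
Lemma adams_ahom_bev (Z X : finType) (v : option Z -> malgebra k {fmonom X}) c t :
  (forall z, primitive (v (Some z))) -> adams (v None) = c *: v None ->
  (None \notin leaves t -> primitive (ahom v (bev k t))) /\
  (count_mem None (leaves t) = 1%N ->
    adams (ahom v (bev k t)) = c *: ahom v (bev k t)).
Proof.
move=> pv vN; elim: t => [[z|]|a [pa ea] b [pb eb]] //=; rewrite ?ahom_var //.
rewrite rmorphB !rmorphM /=; split=> [|].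
  by rewrite mem_cat negb_or => /andP[/pa ? /pb ?]; apply: primitive_comm.
rewrite count_cat; case na: (count_mem None (leaves a)) => [|[|//]].
  move=> /eb {}eb; have /pa {}pa : None \notin leaves a.
    by rewrite -has_pred1 has_count na.
  rewrite -[_ - _]opprB linearN /= adams_comm // eb scalerN scalerBr.
  by rewrite -scalerAl malgebra_scalerAr.
rewrite add1n => -[nb]; have /pb {}pb : None \notin leaves b.
  by rewrite -has_pred1 has_count nb.
rewrite adams_comm // ea // scalerBr.
by rewrite -scalerAl malgebra_scalerAr.
Qed.

Lemma sh_lie_pcomp (X : finType) (Y : {set X}) c
    (l : lie k (option {x : X | x \notin Y})) (u : As k {x : X | x \in Y}) :
  sh k _ u = c *: u ->
  sh k X (as_pcomp (lie_as l) u) = c *: as_pcomp (lie_as l) u.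
Proof.
move=> eu; rewrite as_pcompE.
pose g := @offree k X \o ahom (pcomp_var (tofree u)) \o @tofree k _ \o @lie_as k _.
suff E : sh k X \o g =1 c \*: g by exact: E.
apply: lie_linear_eq => t; rewrite /g /= tofree_lie_br sh_offree -linearZ /=.
congr offree; apply: (adams_ahom_bev (c := c) _ _ _).2 => [z||] /=.
- exact: primitive_var.
- rewrite adams_ahom => [|y]; last exact: primitive_var.
  by rewrite -tofree_sh eu !linearZ.
by rewrite (count_uniq_mem _ _) ?(perm_uniq (valP t)) ?enum_uniq //
  (perm_mem (valP t)) mem_enum.
Qed.

Lemma eigenspace_lie_subbimodule n : lie_subbimodule (sh_eigenspace k n).
Proof.
have S : sub_smodule (sh_eigenspace k n).
  move=> X Y f _ u /sh_eigenspaceP eu; apply/sh_eigenspaceP.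
  by rewrite sh_as_map eu linearZ.
split; split=> // X Y u l.
  move/sh_eigenspaceP => eu; apply/sh_eigenspaceP; rewrite sh_pcomp_lie eu.
  by rewrite !as_pcompE !linearZ.
by move=> /sh_eigenspaceP el; apply/sh_eigenspaceP; apply: sh_lie_pcomp.
Qed.
End Eigenspaces.

(** * Symmetrised products *)

Section Symmetrization.
Variables (k : fieldType) (X : finType).

Lemma shuf_inj n (A : {set 'I_n}) : injective (@shuf X n A).
Proof.
move=> t t' /eq_in_map e; apply: eq_from_tnth => i; apply: e.
by rewrite (perm_mem (enum_setC_perm A)) mem_enum.
Qed.

Fact shuf_listing_subproof (A : {set 'I_#|X|}) (w : listing X) :
  exists w', word w' = shuf A (val w).
Proof.
by apply/is_listingP; rewrite is_listing_shuf; apply/is_listingP; exists w.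
Qed.

(** Each of the 2^n subsets permutes the listings and so fixes their sum. *)
Lemma sh_sym : sh k X (as_sym k X) = 2%:R ^+ #|X| *: as_sym k X.
Proof.
rewrite linearZ scalerA mulrC -scalerA; congr (_ *: _); rewrite linear_sum /=.
under eq_bigr do rewrite sh_word; rewrite exchange_big /=.
have -> : 2%:R ^+ #|X| = \sum_(A : {set 'I_#|X|}) 1 :> k.
  have cE n : #|{: {set 'I_n}}| = (2 ^ n)%N.
    by rewrite -cardsT -powersetT card_powerset cardsT card_ord.
  by rewrite sumr_const cE natrX.
rewrite scaler_suml; apply: eq_bigr => A _; rewrite scale1r.
pose f w := sval (cid (shuf_listing_subproof A w)).
have fE w : word (f w) = shuf A (val w) := svalP (cid (shuf_listing_subproof A w)).
have inj_f : injective f.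
  by move=> w w' /(congr1 (@word X)); rewrite !fE => /shuf_inj/val_inj.
by rewrite [RHS](reindex_inj inj_f); apply: eq_bigr => w _; rewrite fE.
Qed.

Lemma card_listing : (0 < #|X|)%N -> #|{: listing X}| = (#|X|)`!.
Proof.
move=> X0; rewrite card_sig -[RHS]ffactnn -card_uniq_tuples.
apply: eq_card => w; rewrite inE -[LHS]/(uniq w && _) X0 andbT.
by rewrite (introT allP).
Qed.
End Symmetrization.

Lemma sh_sym_ord (k : fieldType) r :
  sh k 'I_r (as_sym k 'I_r) = 2%:R ^+ r *: as_sym k 'I_r.
Proof. by rewrite sh_sym; congr (_ ^+ _ *: _); apply: card_ord. Qed.

Lemma as_sym_ord (k : fieldType) r :
  as_sym k 'I_r = (r`!%:R : k)^-1 *: \sum_w mono (word w).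
Proof. by congr ((_`!)%:R^-1 *: _); apply: card_ord. Qed.

Lemma perm_enumP (X : finType) (s : seq X) :
  reflect (forall x, count_mem x s = 1%N) (perm_eq s (enum X)).
Proof.
apply: (iffP idP) => [/seq.permP e x|e].
  by rewrite e count_uniq_mem ?enum_uniq // mem_enum.
have us : uniq s.
  apply: count_mem_uniq => x; rewrite e; case: (boolP (x \in s)) => //.
  by rewrite -has_pred1 has_count e.
apply: uniq_perm; rewrite ?enum_uniq // => x.
by rewrite mem_enum -has_pred1 has_count e.
Qed.

Section SymmetricProducts.
Variables (k : fieldType) (X : finType).
Hypothesis char0 : [pchar k] =i pred0.

Definition is_partition (R : finType) (T : R -> bracket X) : Prop :=
  forall x, (\sum_i count_mem x (leaves (T i)) = 1)%N.

(** The average over all orders of the product of the r brackets T i, obtained by substituting them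
    for the letters of s_r. *)
Definition sym_product (r : nat) (u : As k X) : Prop :=
  exists2 T : 'I_r -> bracket X, is_partition T &
    u = offree (ahom (fun i => bev k (T i)) (tofree (as_sym k 'I_r))).

Lemma sh_sym_product r u : lspan (sym_product r) u -> sh k X u = 2%:R ^+ r *: u.
Proof.
elim=> [|c _ v [T _ ->] _ IH]; first by rewrite linear0 scaler0.
rewrite linearP /= IH scalerDr scalerA mulrC -scalerA; congr (_ *: _ + _).
rewrite sh_offree adams_ahom => [|i]; last exact: primitive_bev.
by rewrite -tofree_sh sh_sym_ord; do 3!rewrite linearZ /=.
Qed.

Definition bprod (ts : seq (bracket X)) : As k X := offree (\prod_(t <- ts) bev k t).

Definition is_partition_seq (ts : seq (bracket X)) : Prop :=
  forall x, count_mem x (flatten (map (@leaves X) ts)) = 1%N.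

Definition sym_span : As k X -> Prop :=
  lspan (fun u => exists2 r, (0 < r)%N & sym_product r u).

Lemma natr_neq0 n : (0 < n)%N -> n%:R != 0 :> k.
Proof. by move=> n0; rewrite ((pcharf0P k).1 char0) -lt0n. Qed.

Section Straighten.
Variable r : nat.
Hypothesis IH : forall ts, size ts = r -> (0 < r)%N -> is_partition_seq ts ->
  sym_span (bprod ts).

(** The difference is the product with x, y merged into [br x y]; it has r factors, so [IH] covers
    it. *)
Lemma bprod_swap a x y b : size (a ++ x :: y :: b) = r.+1 ->
  is_partition_seq (a ++ x :: y :: b) ->
  sym_span (bprod (a ++ x :: y :: b) - bprod (a ++ y :: x :: b)).
Proof.
move=> sz pt; have -> : bprod (a ++ x :: y :: b) - bprod (a ++ y :: x :: b)
    = bprod (a ++ br x y :: b).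
  rewrite -linearB /bprod !big_cat !big_cons /= -mulrBr.
  by rewrite (mulrA (bev k x)) (mulrA (bev k y)) -mulrBl.
apply: IH.
- by move: sz; rewrite !size_cat /= !addnS => -[].
- by move: sz; rewrite size_cat /= addnS => -[<-]; rewrite addnS.
move=> z; rewrite -(pt z) !map_cat !flatten_cat /= !count_cat.
by rewrite !addnA.
Qed.

Lemma is_partition_seq_perm ts ts' : perm_eq ts ts' ->
  is_partition_seq ts -> is_partition_seq ts'.
Proof.
move=> p pt x; rewrite -(pt x); apply/esym/seq.permP/perm_flatten.
exact: perm_map.
Qed.

(** Sorting by adjacent swaps: the tail of s is rearranged behind its head x, then x moves right
    past b; the prefix [a] holds the factors already settled. *)
Lemma bprod_perm s s' : perm_eq s s' -> forall a, size (a ++ s) = r.+1 ->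
  is_partition_seq (a ++ s) -> sym_span (bprod (a ++ s) - bprod (a ++ s')).
Proof.
elim: s s' => [|x s IHs] s' pss a sz pt.
  by move: pss; rewrite perm_sym => /perm_nilP ->; rewrite subrr; apply: lspan0.
have xs' : x \in s' by rewrite -(perm_mem pss) mem_head.
case/splitPr: xs' pss => b c; rewrite perm_sym -[x :: c]cat1s perm_catCA /= perm_cons.
rewrite perm_sym => pss.
rewrite -(subrKA (bprod (a ++ x :: b ++ c)) (bprod (a ++ x :: s))).
apply: lspanD.
  by have := IHs _ pss (rcons a x); rewrite !cat_rcons; apply.
have {}pt : is_partition_seq (a ++ x :: b ++ c).
  by apply: is_partition_seq_perm pt; rewrite perm_cat2l perm_cons.
have {}sz : size (a ++ x :: b ++ c) = r.+1.
  by rewrite -sz !size_cat /= (perm_size pss) size_cat.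
elim: b a {IHs pss s} pt sz => [|y b IHb] a pt sz.
  by rewrite subrr; apply: lspan0.
rewrite -(subrKA (bprod (a ++ y :: x :: b ++ c)) (bprod (a ++ x :: y :: b ++ c))).
apply: lspanD; first exact: bprod_swap.
have := IHb (rcons a y); rewrite !cat_rcons; apply.
  apply: is_partition_seq_perm pt; rewrite perm_cat2l /=.
  exact: (introT permPl (perm_catCA [:: x] [:: y] (b ++ c))).
by rewrite -sz !size_cat.
Qed.
End Straighten.

Lemma bprod_sym_span ts : (0 < size ts)%N -> is_partition_seq ts ->
  sym_span (bprod ts).
Proof.
move: {2}(size ts) (erefl (size ts)) => r.
elim: r ts => [|r IHr] ts sz; first by rewrite sz.
move=> _ pt.
have IH ts' : size ts' = r -> (0 < r)%N -> is_partition_seq ts' -> sym_span (bprod ts').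
  by move=> e r0; apply: IHr; rewrite ?e.
pose t : r.+1.-tuple (bracket X) := Tuple (introT eqP sz).
have partE : is_partition (tnth t).
  move=> x; rewrite -(pt x) count_flatten -map_comp sumnE big_map.
  by rewrite -[ts in RHS]/(tval t) big_tuple.
pose c : k := (r.+1)`!%:R^-1.
have cE : c * #|{: listing 'I_r.+1}|%:R = 1.
  by rewrite card_listing !card_ord // mulVf // natr_neq0 // fact_gt0.
pose v (a : listing 'I_r.+1) := map (tnth t) (word a).
have vE : offree (ahom (fun i => bev k (tnth t i)) (tofree (as_sym k 'I_r.+1)))
    = c *: \sum_a bprod (v a).
  rewrite as_sym_ord !linearZ /=; congr (_ *: _).
  rewrite !linear_sum; apply: eq_bigr => a _ /=.
  by rewrite tofree_word ahom_mon /bprod big_map.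
(* The product is its symmetrisation plus the average of its differences with the reordered
   products; the latter fall under the induction hypothesis. *)
have -> : bprod ts = c *: \sum_a bprod (v a) + c *: \sum_a (bprod ts - bprod (v a)).
  rewrite sumrB -scalerDr addrC subrK sumr_const -scaler_nat scalerA cE.
  by rewrite scale1r.
rewrite -vE; apply: lspanD.
  by apply: lspan_rel; exists r.+1 => //; exists (tnth t).
apply: lspanZ.
apply: (big_ind sym_span); [exact: lspan0|exact: lspanD|move=> a _].
have p : perm_eq ts (v a).
  rewrite /v -[X in perm_eq X _](map_tnth_enum t); apply: perm_map.
  by rewrite perm_sym; case/andP: (introT (is_listingP _) (ex_intro _ a erefl)).
exact: (bprod_perm IH p (a := [::])).
Qed.

Lemma sym_spanT (u : As k X) : sym_span u.
Proof.
apply: lspan_trans (lspan_as u) => _ [w ->].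
have /andP[/perm_enumP pw w0] := introT (is_listingP _) (ex_intro _ w erefl).
have : sym_span (bprod (map bvar (word w))).
  apply: bprod_sym_span => [|x]; first by rewrite size_map.
  by rewrite -map_comp /= -(pw x) /= flatten_seq1.
by rewrite /bprod big_map -mon_prod1 offree_mon.
Qed.

(** [z n] collects the products with n + 1 factors. The equality for all large M allows two
    decompositions to be cut at a common length. *)
Lemma sym_product_decomposition (u : As k X) : exists z : nat -> As k X,
  (forall n, lspan (sym_product n.+1) (z n)) /\
  exists N, forall M, (N <= M)%N -> u = \sum_(n < M) z n.
Proof.
elim: (sym_spanT u) => [|c x v [[//|r] _ xr] _ [z [Lz [N zN]]]].
  by exists (fun=> 0); split=> [n|]; [apply: lspan0|exists 0%N => M _; rewrite big1].
exists (fun n => (if n == r then c *: x else 0) + z n); split=> [n|].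
  case: eqP => [->|_]; last by rewrite add0r.
  by apply: lspanZD => //; apply: lspan_rel.
exists (maxn N r.+1) => M; rewrite geq_max => /andP[/zN {1}-> rM].
rewrite big_split /= -big_mkcond /=; congr (_ + _).
by rewrite (big_pred1 (Ordinal rM)).
Qed.
End SymmetricProducts.

(** * Independence of eigenvectors with distinct eigenvalues *)

Section DirectSum.
Variable k : fieldType.
Hypothesis char0 : [pchar k] =i pred0.

(** Applying f - a_N to the relation removes the last term and multiplies the others by the nonzero
    scalars a_n - a_N. *)
Lemma eigenvectors_independent (V : vectType k) (f : 'End(V)) (a : nat -> k) :
  injective a -> forall N (u : nat -> V), (forall n, f (u n) = a n *: u n) ->
  \sum_(n < N) u n = 0 -> forall n, (n < N)%N -> u n = 0.
Proof.
move=> inj_a; elim=> [|N IH] u fu // s0.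
have u0 n : (n < N)%N -> u n = 0.
  move=> lt_nN; suff e0 : (a n - a N) *: u n = 0.
    move/eqP: e0; rewrite scaler_eq0 subr_eq0 (inj_eq inj_a) ltn_eqF //=.
    by move/eqP.
  apply: (IH (fun n => (a n - a N) *: u n)) => // [m|].
    by rewrite linearZ /= fu !scalerA mulrC.
  have := congr1 f s0; rewrite linear0 linear_sum /= => e.
  have := congr1 (fun x => a N *: x) s0; rewrite scaler0 scaler_sumr /= => e'.
  have : \sum_(n < N.+1) (a n - a N) *: u n = 0.
    under eq_bigr do rewrite scalerBl -fu.
    by rewrite sumrB e e' subr0.
  by rewrite big_ord_recr /= subrr scale0r addr0.
move=> n; rewrite ltnS leq_eqVlt => /orP[/eqP->|/u0//].
by move: s0; rewrite big_ord_recr /= big1 ?add0r // => i _; apply: u0.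
Qed.

Lemma pow2_inj : injective (fun n => 2%:R ^+ n.+1 : k).
Proof.
move=> m n /eqP; rewrite -!natrX.
wlog le_mn : m n / (m <= n)%N.
  by move=> W; case/orP: (leq_total m n) => /W // H /eqP/esym/eqP/H.
rewrite eq_sym -subr_eq0 -natrB ?leq_exp2l // ((pcharf0P k).1 char0) subn_eq0.
by rewrite leq_exp2l // ltnS => le_nm; apply/eqP; rewrite eqn_leq le_mn.
Qed.
End DirectSum.

(** * The image of zeta *)

Lemma bracket_restrict (X : Type) (P : pred X) (t : bracket X) :
  all P (leaves t) -> {t' : bracket {x | P x} | bracket_map val t' = t}.
Proof.
elim: t => [x|a IHa b IHb] /=.
  by rewrite andbT => Px; exists (bvar (exist _ x Px)).
rewrite all_cat => /andP[/IHa[a' ea] /IHb[b' eb]].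
by exists (br a' b'); rewrite /= ea eb.
Qed.

Section ZetaImage.
Variables (k : fieldType) (X : finType).

Lemma partition_unique (R : finType) (T : R -> bracket X) : is_partition T ->
  exists p : X -> R, forall x i, count_mem x (leaves (T i)) = (p x == i) :> nat.
Proof.
move=> pT.
have /choice[p pP] x : exists i, (0 < count_mem x (leaves (T i)))%N.
  apply/existsP; apply: contraT => /existsPn n0.
  have := pT x; rewrite big1 // => i _; apply/eqP.
  by rewrite -leqn0 leqNgt n0.
exists p => x i; have := pT x; rewrite (bigD1 (p x)) //=.
have := pP x; case en: (count_mem x (leaves (T (p x)))) => [//|n] _.
rewrite addSn => -[] /eqP; rewrite addn_eq0 => /andP[/eqP n0].
case: (eqVneq (p x) i) => [<- _|npi]; first by rewrite en n0.
by rewrite sum_nat_eq0 => /forallP/(_ i); rewrite eq_sym npi => /eqP.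
Qed.

Lemma count_val (P : pred X) (s : seq {x | P x}) x : perm_eq s (enum {: {x | P x}}) ->
  count_mem x (map val s) = P x :> nat.
Proof.
move=> /seq.permP ps; rewrite count_map ps.
case: (boolP (P x)) => Px.
  rewrite (_ : count _ _ = count_mem (exist _ x Px) (enum {: {x | P x}})).
    by rewrite count_uniq_mem ?enum_uniq // mem_enum.
  by apply: eq_count => y.
apply/eqP; rewrite -leqn0 leqNgt -has_count.
by apply/hasPn => y _; apply: contraNneq Px => <-; apply: (valP y).
Qed.

(** Brackets on X with disjoint leaves are turned into the fibrewise data of [SGen]. *)
Lemma partition_fibres (R : finType) (T : R -> bracket X) : is_partition T ->
  exists (p : X -> R) (t : forall i, mbracket (fib p i)),
    forall i, bracket_map val (val (t i)) = T i.
Proof.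
move=> /partition_unique[p pP]; exists p.
suff t i : {t : mbracket (fib p i) | bracket_map val (val t) = T i}.
  by exists (fun i => sval (t i)) => i; exact: (svalP (t i)).
have [|t et] := @bracket_restrict X (fun x => p x == i) (T i).
  apply/allP => x; rewrite -has_pred1 has_count pP; by case: (p x == i).
have pt : perm_eq (leaves t) (enum {: fib p i}).
  apply/perm_enumP => x; have := pP (val x) i; rewrite -et leaves_map count_map.
  by rewrite (valP x) /= => <-; apply: eq_count => y.
by exists (exist _ t pt).
Qed.

Lemma fibres_partition (R : finType) (p : X -> R) (t : forall i, mbracket (fib p i)) :
  is_partition (fun i => bracket_map val (val (t i))).
Proof.
move=> x; under eq_bigr => i _ do
  rewrite leaves_map (count_val (P := fun x => p x == i) _ (valP (t i))).
by rewrite (bigD1 (p x)) //= eqxx big1 // => i /negPf; rewrite eq_sym => ->.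
Qed.

Lemma as_comp_lie_br (R : finType) (p : X -> R) (u : As k R)
    (t : forall i, mbracket (fib p i)) :
  as_comp u (fun i => lie_as (lie_br k (t i))) =
  offree (ahom (fun i => bev k (bracket_map val (val (t i)))) (tofree u)).
Proof.
rewrite as_compE; congr offree; apply: eq_ahom => i.
by rewrite /comp_var tofree_lie_br bev_map.
Qed.

Lemma as_comp_lie_multilinear (R : finType) (p : X -> R) (u : As k R) :
  multilinear (fun l : forall i, lie k (fib p i) => as_comp u (fun i => lie_as (l i))).
Proof.
move=> j c l l' l'' ej ei; apply: (@as_comp_bot _ _ _ _ _ j).
  by rewrite ej linearP.
by move=> i /ei [-> ->].
Qed.

Lemma as_comp_sym_lie r (p : X -> 'I_r) (l : forall i, lie k (fib p i)) :
  lspan (sym_product r) (as_comp (as_sym k 'I_r) (fun i => lie_as (l i))).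
Proof.
apply: (multilinear_span (as_comp_lie_multilinear (as_sym k 'I_r))
  (S := fun i x => exists t, x = lie_br k t)) l => [i x|||l Sl].
- exact: lspan_lie.
- exact: lspan0.
- by move=> c u v su sv; apply: lspanZD.
have [t tE] : exists t : forall i, mbracket (fib p i), forall i, l i = lie_br k (t i).
  by exists (fun i => sval (cid (Sl i))) => i; apply: (svalP (cid (Sl i))).
have -> : l = fun i => lie_br k (t i) by apply: functional_extensionality_dep.
apply: lspan_rel; rewrite as_comp_lie_br.
by exists (fun i => bracket_map val (val (t i))) => //; apply: fibres_partition.
Qed.

Definition com_one (Z : finType) : com k Z := [ffun=> 1].

Lemma com_as_one r : (0 < r)%N -> com_as (com_one 'I_r) = as_sym k 'I_r.
Proof.
move=> r0; rewrite /com_as.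
have e0 : (0 < #|'I_r|)%N by rewrite card_ord.
rewrite (big_pred1 (exist _ tt e0)) => [|e]; first by rewrite ffunE scale1r.
by apply/esym/eqP/val_inj; case: (val e).
Qed.

Lemma zeta_pi u : zeta (lq_pi (@scomp_rel k (Com k) (Lie k) X) u) = zeta0 u.
Proof. exact: lq_lift_pi. Qed.

Lemma scomp_arityZD n c (z z' : scomp (Com k) (Lie k) X) :
  scomp_arity n z -> scomp_arity n z' -> scomp_arity n (c *: z + z').
Proof.
case=> u hu -> [u' hu' ->]; exists (c *: u + u'); last by rewrite linearP.
move=> g /(fsubsetP (msuppD_le _ _)); rewrite in_fsetU => /orP[|/hu'//].
by move/(fsubsetP (msuppZ_le _ _))/hu.
Qed.

(** Com(r) is a line sent to multiples of s_r, so a generator of arity r maps to a multiple of s_r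
    composed with Lie elements, which expand multilinearly into brackets. *)
Lemma zeta_arityP r (u : As k X) : (0 < r)%N ->
  lspan (sym_product r) u <->
  exists2 z : scomp (Com k) (Lie k) X, scomp_arity r z & zeta z = u.
Proof.
move=> r0; split=> [|[_ [v hv ->] <-]].
  elim=> [|c x w [T pT ->] _ [z hz <-]].
    exists 0; last exact: linear0.
    by exists 0; [move=> g; rewrite msupp0|rewrite linear0].
  have [p [t tE]] := partition_fibres pT.
  pose g := @SGen k (Com k) (Lie k) X r r0 p (com_one _) (fun i => lie_br k (t i)).
  exists (c *: lq_pi (@scomp_rel _ _ _ _) (sfree g) + z).
    apply: scomp_arityZD => //; exists (sfree g) => // h.
    by rewrite msuppU oner_eq0 in_fset1 => /eqP ->.
  rewrite linearP /= zeta_pi zeta0_gen /zeta_gen /= com_as_one // as_comp_lie_br.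
  by congr (_ *: offree _ + _); apply: eq_ahom => i; rewrite tE.
rewrite zeta_pi /zeta0 /malg_lift big_seq.
apply: (big_ind (lspan (sym_product r))) => [|x y sx sy|g /hv].
- exact: lspan0.
- exact: lspanD.
move: v@_g => c; case: g => n n0 p a b /= en; subst n.
have -> : zeta_gen (SGen n0 a b) =
    (\sum_e a e : k) *: as_comp (as_sym k 'I_r) (fun i => lie_as (b i)).
  by rewrite /zeta_gen /com_as as_compE [in RHS]as_compE; do 3!rewrite linearZ /=.
rewrite scalerA; apply: lspanZ.
exact: as_comp_sym_lie.
Qed.
End ZetaImage.

Lemma big_option (R : finType) (F : option R -> nat) :
  (\sum_o F o = F None + \sum_i F (Some i))%N.
Proof.
rewrite (perm_big (None :: map Some (enum R))) => [|].
  by rewrite big_cons big_map big_enum.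
apply: uniq_perm; rewrite ?index_enum_uniq //=.
  rewrite map_inj_uniq ?enum_uniq ?andbT; last exact: Some_inj.
  by apply/mapP => -[].
move=> [i|]; rewrite mem_index_enum ?inE //=.
by rewrite map_f ?mem_enum.
Qed.

(** * The right Lie-module generated by the symmetrised monomial *)

Fixpoint nbr (T : Type) (t : bracket T) : nat :=
  if t is br a b then (nbr a + nbr b).+1 else 0%N.

Section RightModuleGenerated.
Variable k : fieldType.

Lemma tofree_as_map (Y Z : finType) (f : Y -> Z) (u : As k Y) : (0 < #|Z|)%N ->
  bijective f -> tofree (as_map f u) = relab f (tofree u).
Proof.
move=> Z0 bf; rewrite as_mapE homog_offreeK //.
have := homog_ahom (d := fun y => [:: f y]) _ (homog_tofree u).
move/(_ (fun y => mon k [:: f y])) => h.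
apply: homog_perm (h _); last by move=> y; apply: homog_mon.
rewrite flatten_map1; apply: uniq_perm; rewrite ?enum_uniq //.
  by rewrite map_inj_uniq ?enum_uniq //; apply: bij_inj.
have [g fK gK] := bf.
by move=> z; rewrite mem_enum -[z]gK map_f ?mem_enum.
Qed.

(* option R is R with the letter j split into the two letters Some j and None, *)
(* whose commutator is substituted for j.                                      *)
Section AddLetter.
Variables (R : finType) (j : R).

Definition new_pair : {set option R} := [set Some j; None].
Local Notation inner := {x : option R | x \in new_pair}.
Local Notation outer := (option {x : option R | x \notin new_pair}).

(** [insub] fails exactly at i = j, which is thereby sent to the composition slot [None]. *)
Definition to_outer (i : R) : outer := insub (Some i).

Lemma to_outer_j : to_outer j = None.
Proof. by rewrite /to_outer insubN // negbK !inE eqxx. Qed.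

Lemma to_outerP i : i != j -> exists2 z, to_outer i = Some z & val z = Some i.
Proof.
move=> nij; rewrite /to_outer; case: insubP => [z _ ez|]; first by exists z.
by rewrite !inE orbF negbK (inj_eq Some_inj) (negPf nij).
Qed.

Lemma to_outer_bij : bijective to_outer.
Proof.
exists (fun o : outer => if o is Some z then odflt j (val z) else j) => [i|[z|]].
- have [->|/to_outerP[z -> ->]] := eqVneq i j; by rewrite ?to_outer_j.
- have := valP z; case ez : (val z) => [i|]; last by rewrite !inE orbT.
  by move=> _; rewrite /to_outer -ez valK.
exact: to_outer_j.
Qed.

Definition pair_letter (i : option R) (h : i \in new_pair) : inner := exist _ i h.

Fact Some_new : Some j \in new_pair. Proof. by rewrite !inE eqxx. Qed.
Fact None_new : None \in new_pair. Proof. by rewrite !inE orbT. Qed.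

Definition pair_bracket : bracket inner :=
  br (bvar (pair_letter Some_new)) (bvar (pair_letter None_new)).

Fact pair_bracket_subproof : perm_eq (leaves pair_bracket) (enum {: inner}).
Proof.
apply: uniq_perm; rewrite ?enum_uniq //= => -[x xP].
by rewrite mem_enum !inE -!val_eqE /=; move: (xP); rewrite !inE.
Qed.

Definition pair_mbracket : mbracket inner :=
  exist _ pair_bracket pair_bracket_subproof.

Definition insert_bracket (u : As k R) : As k (option R) :=
  as_pcomp (as_map to_outer u) (lie_as (lie_br k pair_mbracket)).

Lemma tofree_insert_bracket (u : As k R) :
  tofree (insert_bracket u) = ahom (fun i => if i == j
    then bev k (br (bvar (Some j)) (bvar None)) else mon k [:: Some i]) (tofree u).
Proof.
pose v := pcomp_var (tofree (lie_as (lie_br k pair_mbracket))).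
have e : ahom v (relab to_outer (tofree u)) = ahom (fun i => if i == j
    then bev k (br (bvar (Some j)) (bvar None)) else mon k [:: Some i]) (tofree u).
  rewrite /relab ahom_comp; apply: eq_ahom => i; rewrite ahom_var /v.
  have [->|nij] := eqVneq i j; last by have [z -> /= ->] := to_outerP nij.
  by rewrite to_outer_j /= tofree_lie_br /relab -bev_map.
rewrite /insert_bracket as_pcompE tofree_as_map; last exact: to_outer_bij.
  rewrite -/v e homog_offreeK //; first by apply/card_gt0P; exists None.
  (* [d i] is the multidegree of the image of i; jointly these use each letter of [option R] once,
     so [offree] loses nothing. *)
  pose d i := if i == j then [:: Some j; None] else [:: Some i].
  have := homog_ahom (d := d) _ (homog_tofree u).
  move=> h; apply: homog_perm (h _ _); last first.
    move=> i; rewrite /d; case: ifP => _; last exact: homog_mon.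
    exact: (homog_bev k (br (bvar (Some j)) (bvar None))).
  apply/perm_enumP => x; rewrite count_flatten -map_comp sumnE big_map big_enum /=.
  pose i0 := odflt j x; rewrite (bigD1 i0) //= big1 => [|i ni].
    rewrite addn0 /d /i0; case: x {i0} => [i|] /=; last by rewrite eqxx.
    by case: eqVneq => [->|_] /=; rewrite ?eqxx.
  rewrite /d; case: x @i0 ni => [i'|] /= ni; last by rewrite (negPf ni).
  have nS : (Some i == Some i' :> option R) = false by apply: negbTE.
  by case: ifP => [/eqP ej|_]; rewrite -?ej /= ?nS.
by apply/card_gt0P; exists None.
Qed.
End AddLetter.

(** Induction on the total number of brackets. Without brackets, T is a relabelling; otherwise some
    T j is [br a b], and composing u with a commutator at j lets a and b be substituted as separate
    factors. *)
Lemma right_module_composition (M : forall X : finType, {vspace As k X})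
    (X R : finType) (T : R -> bracket X) (u : As k R) :
  right_lie_submodule M -> u \in M R -> is_partition T ->
  offree (ahom (fun i => bev k (T i)) (tofree u)) \in M X.
Proof.
case=> Mmap Mcomp; move: {2}(\sum_i nbr (T i))%N (erefl (\sum_i nbr (T i))%N) => m.
elim: m R T u => [|m IH] R T u em Mu pT.
  have /choice[f fE] i : exists x, T i = bvar x.
    case eT : (T i) => [x|a b]; first by exists x.
    by move: em; rewrite (bigD1 i) //= eT.
  have pf x : (\sum_i (f i == x) = 1)%N.
    by rewrite -(pT x); apply: eq_bigr => i _; rewrite fE /= addn0.
  have /choice[g gK] x : exists i, f i = x.
    apply/'exists_eqP; apply: contraT; rewrite negb_exists => /forallP n0.
    by have := pf x; rewrite big1 // => i _; rewrite (negPf (n0 i)).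
  have bf : bijective f.
    exists g => // i; apply/eqP; apply: contraT => ngi.
    by have := pf (f i); rewrite (bigD1 i) //= eqxx (bigD1 (g (f i))) //= gK eqxx.
  rewrite (@eq_ahom _ _ _ _ (fun i => mon k [:: f i])) => [|i]; last by rewrite fE.
  by rewrite -[ahom _ _]/(relab f _) -as_mapE Mmap.
have [j [a [b eT]]] : exists j a b, T j = br a b.
  have : (0 < \sum_i nbr (T i))%N by rewrite em.
  rewrite lt0n sum_nat_eq0 negb_forall => /existsP[j] /=.
  by case eT : (T j) => [x|a b] // _; exists j, a, b.
pose T' (o : option R) := if o is Some i then if i == j then a else T i else b.
(* Used with F = [nbr] for the descent and with F counting a leaf for the partition property. *)
have sumE (F : bracket X -> nat) : (\sum_o F (T' o) + F (br a b) =
    F a + F b + \sum_i F (T i))%N.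
  have -> : (\sum_o F (T' o) = F b + \sum_i F (T' (Some i)))%N.
    exact: (big_option (fun o => F (T' o))).
  rewrite (bigD1 j) //= eqxx [in RHS](bigD1 j) //= eT.
  rewrite (eq_bigr (fun i => F (T i))) => [|i /negPf ->] //.
  by rewrite [(F b + _)%N]addnCA -!addnA [(_ + F (br a b))%N]addnC.
have -> : ahom (fun i => bev k (T i)) (tofree u) =
    ahom (fun o => bev k (T' o)) (tofree (insert_bracket j u)).
  rewrite tofree_insert_bracket ahom_comp; apply: eq_ahom => i.
  case: eqVneq => [->|nij]; last by rewrite ahom_var /= (negPf nij).
  by rewrite rmorphB !rmorphM /= !ahom_var /= eqxx eT.
apply: IH.
- by apply/eqP; rewrite -eqSS -em -(eqn_add2r (nbr a + nbr b)) addSnnS sumE addnC.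
- by apply: Mcomp; apply: Mmap => //; apply: to_outer_bij.
move=> x; apply/eqP; rewrite -(eqn_add2r (count_mem x (leaves (br a b)))).
by rewrite (sumE (fun t => count_mem x (leaves t))) pT /= count_cat addnC.
Qed.

Lemma sym_product_generated r (X : finType) (u : As k X) :
  lspan (@sym_product k X r) u -> right_lie_generated (as_sym k 'I_r) u.
Proof.
move=> su M mM Ms; elim: su => [|c _ v [T pT ->] _ IH]; first exact: mem0v.
by rewrite memvD // memvZ //; apply: right_module_composition.
Qed.
End RightModuleGenerated.

(** * Injectivity of zeta *)

Definition left_normed (T : Type) (m : T) (s : seq T) : bracket T :=
  foldl (fun t y => br t (bvar y)) (bvar m) s.

Lemma leaves_left_normed (T : Type) (m : T) s : leaves (left_normed m s) = m :: s.
Proof.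
rewrite /left_normed -[m :: s]/(leaves (bvar m) ++ s).
elim: s (bvar m) => [|y s IH] t /=; first by rewrite cats0.
by rewrite IH /= -catA.
Qed.

Lemma left_normed_map (T U : Type) (f : T -> U) (m : T) s :
  bracket_map f (left_normed m s) = left_normed (f m) (map f s).
Proof.
rewrite /left_normed -[bvar (f m)]/(bracket_map f (bvar m)).
by elim: s (bvar m) => [|y s IH] t //=; rewrite IH.
Qed.

Lemma left_normed_rcons (T : Type) (m : T) s y :
  left_normed m (rcons s y) = br (left_normed m s) (bvar y).
Proof. by rewrite /left_normed -cats1 foldl_cat. Qed.

(** Relators are homogeneous: either all terms of one are multilinear on Z, or none is. *)
Lemma relator_leaves (X : choiceType) (s : seq (bracket X)) : relator s ->
  exists l, all (fun t => perm_eq (leaves t) l) s.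
Proof.
elim=> [a b|a b c|t {}s _ [l IH]|t {}s _ [l IH]].
- by exists (leaves (br a b)); rewrite /= perm_refl perm_catC perm_refl.
- exists (leaves (br (br a b) c)); rewrite /= perm_refl /= andbT; apply/andP; split.
    by rewrite perm_catC catA perm_refl.
  by rewrite -catA perm_catC perm_refl.
- exists (l ++ leaves t); rewrite all_map; apply: sub_all IH => u /= pu.
  by rewrite perm_cat2r.
exists (leaves t ++ l); rewrite all_map; apply: sub_all IH => u /= pu.
by rewrite perm_cat2l.
Qed.

Section LeftNormedSpan.
Variables (k : fieldType) (Z : finType) (m : Z).
Local Notation V := {malg k[bracket Z]}.

Definition any_relator (v : V) : Prop :=
  exists2 s : seq (bracket Z), relator s & v = \sum_(t <- s) << t >>.

(** The span is taken among all brackets on Z, multilinear or not, so that inductions may pass to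
    subbrackets. *)
Definition left_normed_span : V -> Prop :=
  lspan (fun v => any_relator v \/ exists s, v = << left_normed m s >>).

Definition bracket_with (t : bracket Z) : V -> V := malg_lift (fun s => << br s t >>).
HB.instance Definition _ t := GRing.Linear.on (bracket_with t).

Lemma bracket_withU t s : bracket_with t << s >> = << br s t >>.
Proof. exact: malg_liftU. Qed.

Lemma left_normed_relator s : relator s -> left_normed_span (\sum_(t <- s) << t >>).
Proof. by move=> rs; apply: lspan_rel; left; exists s. Qed.

(** Induction on t, using [n, [a, b]] = [[n, a], b] - [[n, b], a], which is Jacobi combined with
    antisymmetry. *)
Lemma left_normed_span_bracket t v :
  left_normed_span v -> left_normed_span (bracket_with t v).
Proof.
have rel_closed t' v' : any_relator v' -> left_normed_span (bracket_with t' v').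
  case=> s rs ->; rewrite linear_sum /=; under eq_bigr do rewrite bracket_withU.
  by rewrite -(big_map (fun a => br a t') xpredT (fun a => << a >>));
    apply/left_normed_relator/rel_left.
elim: t v => [y|a IHa b IHb] v.
  apply: lspan_bind => r [/rel_closed|[s ->]]; first exact.
  by apply: lspan_rel; right; exists (rcons s y);
    rewrite /= bracket_withU left_normed_rcons.
apply: lspan_bind => r [/rel_closed|[s ->]]; first exact.
rewrite /= bracket_withU; set n := left_normed m s.
have n_in : left_normed_span << n >> by apply: lspan_rel; right; exists s.
have := IHb _ (IHa _ n_in); rewrite /= !bracket_withU => nab.
have := IHa _ (IHb _ n_in); rewrite /= !bracket_withU => nba.
have := left_normed_relator (rel_anti n (br a b)); rewrite big_cons big_seq1 => r1.
have := left_normed_relator (rel_jacobi n a b); rewrite sum3 => r2.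
have := left_normed_relator (rel_left a (rel_anti n b)); rewrite big_cons big_seq1 => r3.
have q3 : left_normed_span << br (br b n) a >>.
  rewrite -(addKr << br (br n b) a >> << br (br b n) a >>).
  exact: lspanD (lspanN nba) r3.
have q2 : left_normed_span << br (br a b) n >>.
  rewrite -(addKr << br (br n a) b >> << br (br a b) n >>).
  rewrite -[_ + << br (br a b) n >>](addrK << br (br b n) a >>).
  exact: lspanD (lspanN nab) (lspanD r2 (lspanN q3)).
rewrite -(addrK << br (br a b) n >> << br n (br a b) >>).
exact: lspanD r1 (lspanN q2).
Qed.

Lemma left_normed_spanP t : m \in leaves t -> left_normed_span << t >>.
Proof.
elim: t => [y|a IHa b IHb] /=.
  by rewrite inE => /eqP <-; apply: lspan_rel; right; exists [::].
rewrite mem_cat => /orP[/IHa na|/IHb nb].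
  by have := left_normed_span_bracket b na; rewrite bracket_withU.
have := left_normed_relator (rel_anti a b); rewrite big_cons big_seq1 => r1.
rewrite -(addrK << br b a >> << br a b >>).
have nba := left_normed_span_bracket a nb; rewrite bracket_withU in nba.
exact: lspanD r1 (lspanN nba).
Qed.

(** Brackets that are not multilinear on Z go to 0. *)
Definition to_lie : V -> lie k Z :=
  malg_lift (fun t => oapp (@lie_br k Z) 0 (insub t)).
HB.instance Definition _ := GRing.Linear.on to_lie.

Lemma to_lieU t : to_lie << t >> = oapp (@lie_br k Z) 0 (insub t).
Proof. exact: malg_liftU. Qed.

Lemma to_lie_relator v : any_relator v -> to_lie v = 0.
Proof.
case=> s rs ->; rewrite linear_sum /=; under eq_bigr do rewrite to_lieU.
have [l /allP hl] := relator_leaves rs.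
case: (boolP (perm_eq l (enum Z))) => pl; last first.
  rewrite big_seq big1 // => t /hl pt; rewrite insubN //.
  by apply: contra pl; apply: perm_trans; rewrite perm_sym.
have [s' es] : exists s' : seq (mbracket Z), map val s' = s.
  exists (pmap insub s); rewrite pmap_filter; last exact: insubK.
  by apply/all_filterP/allP => t /hl pt; rewrite insubT //; apply: perm_trans pt pl.
rewrite -es big_map; under eq_bigr do rewrite valK /=.
rewrite /lie_br -raddf_sum -[RHS](raddf0 (lq_pi (@lie_rel k Z))); apply/lq_piP.
by rewrite subr0; apply: lspan_rel; exists s' => //; rewrite es.
Qed.

Lemma lspan_left_normed (l : lie k Z) :
  lspan (fun r => exists t, (exists s, val t = left_normed m s) /\ r = lie_br k t) l.
Proof.
apply: lspan_trans (lspan_lie l) => _ [t ->].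
have -> : lie_br k t = to_lie << val t >> by rewrite to_lieU valK.
have : left_normed_span << val t >>.
  by apply: left_normed_spanP; rewrite (perm_mem (valP t)) mem_enum.
apply: lspan_bind => r [rr|[s ->]] /=.
  by rewrite to_lie_relator //; apply: lspan0.
rewrite to_lieU; case: insubP => [t' _ et|_] /=; last exact: lspan0.
by apply: lspan_rel; exists t'; split=> //; exists s.
Qed.
End LeftNormedSpan.

Section MinimumFirst.
Variables (k : fieldType) (Z : finType) (f : Z -> nat).

Lemma lspan_lie_min (l : lie k Z) :
  lspan (fun r => exists t m s, [/\ r = lie_br k t, val t = left_normed m s
    & forall y, (f m <= f y)%N]) l.
Proof.
case: (pickP (fun _ : Z => true)) => [z0 _|Z0].
  case: (arg_minnP (P := xpredT) f (i0 := z0) isT) => m _ min_m.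
  apply: (lspan_trans _ (lspan_left_normed m l)) => _ [t [[s et] ->]].
  by apply: lspan_rel; exists t, m, s; split=> // y; apply: min_m.
(* Z is empty here, and a bracket has at least one leaf. *)
apply: (lspan_trans _ (lspan_lie l)) => _ [t ->].
have := leaves_gt0 (val t); case: (leaves (val t)) => // z s _.
by have := Z0 z.
Qed.
End MinimumFirst.

Section Blocks.
Variables (X : eqType) (f : X -> nat).

Definition bhead (B : seq X) : nat := if B is m :: _ then f m else 0%N.
Definition block (B : seq X) : bool :=
  if B is m :: s then all (fun y => f m < f y)%N s else false.
Definition block_seq (G : seq (seq X)) : bool :=
  all block G && sorted gtn (map bhead G).

(* A word is cut into its blocks at its left-to-right minima.                 *)
Lemma flatten_block_seq_inj G G' : block_seq G -> block_seq G' ->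
  flatten G = flatten G' -> G = G'.
Proof.
(* After the head m, the block ends just before the first letter smaller than m. *)
have cut m s s' F F' : all (fun y => f m < f y)%N s -> all (fun y => f m < f y)%N s' ->
    (if F is y :: _ then f y < f m else true)%N ->
    (if F' is y :: _ then f y < f m else true)%N ->
    s ++ F = s' ++ F' -> s = s' /\ F = F'.
  move=> as_ as' hF hF'; elim: s s' as_ as' => [|x s IH] [|x' s'] //=.
  - by move=> _ /andP[mx _] eF; move: hF; rewrite eF ltnNge ltnW.
  - by move=> /andP[mx _] _ eF; move: hF'; rewrite -eF ltnNge ltnW.
  by move=> /andP[_ a1] /andP[_ a2] [-> /(IH _ a1 a2)[-> ->]].
have headF B G1 : block_seq (B :: G1) ->
    (if flatten G1 is y :: _ then f y < bhead B else true)%N.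
  case: G1 => [|[|y C] G1] //=; first by rewrite /block_seq /= andbF.
  by case/andP=> _ /= /andP[].
have tailB B G1 : block_seq (B :: G1) -> block_seq G1.
  by case/andP=> /= /andP[_ aG] /path_sorted sG; apply/andP.
elim: G G' => [|B G IH] [|B' G'] //.
- by case/andP => _ _ /andP[/andP[]]; case: B'.
- by move=> /andP[/andP[]]; case: B.
move=> vG vG'; have := headF _ _ vG; have := headF _ _ vG'.
have := tailB _ _ vG; have := tailB _ _ vG'.
case/andP: vG => /andP[bB _] _; case/andP: vG' => /andP[bB' _] _.
case: B bB => // m s bB; case: B' bB' => // m' s' bB' /= v' v h' h [em eF].
subst m'; have [-> eG] := cut m s s' _ _ bB bB' h h' eF.
by rewrite (IH _ v v' eG).
Qed.

Lemma sort_block_seq (G : seq (seq X)) : all block G -> uniq (map bhead G) ->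
  exists2 G', perm_eq G' G & block_seq G'.
Proof.
move=> aG uG; pose le B C := (bhead C <= bhead B)%N.
have le_total : total le by move=> B C; apply: leq_total.
exists (sort le G); first by rewrite perm_sort.
rewrite /block_seq all_sort aG gtn_sorted_uniq_geq sorted_map sort_sorted // andbT.
have /(perm_map bhead)/perm_uniq -> // : perm_eq (sort le G) G by rewrite perm_sort.
Qed.
End Blocks.

Section ZetaInjective.
Variables (k : fieldType) (X : finType).
Local Notation S := (scomp (Com k) (Lie k) X).
Local Notation rel := (@scomp_rel k (Com k) (Lie k) X).

Definition sclass r (r0 : (0 < r)%N) (p : X -> 'I_r) (a : com k 'I_r)
  (b : forall i, lie k (fib p i)) : S :=
  lq_pi rel (sfree (@SGen k (Com k) (Lie k) X r r0 p a b)).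

Lemma sclass_top r (r0 : (0 < r)%N) (p : X -> 'I_r) a b :
  sclass r0 a b = (\sum_e a e : k) *: sclass r0 (p := p) (com_one k _) b.
Proof.
have lin c u u' : sclass r0 (c *: u + u') b = c *: sclass r0 u b + sclass r0 u' b.
  by rewrite /sclass -linearP; apply/lq_piP; apply: lspan_rel; apply: scomp_top.
have z0 : sclass r0 0 b = 0.
  have := lin 1 0 0; rewrite scaler0 addr0 scale1r => e.
  by apply/(addrI (sclass r0 0 b)); rewrite -e addr0.
have aE : a = (\sum_e a e : k) *: com_one k _ + 0.
  apply/ffunP => e; rewrite !ffunE addr0 [RHS]mulr1 (big_pred1 e) // => e'.
by rewrite {1}aE lin z0 addr0.
Qed.

Lemma sclass_multilinear r (r0 : (0 < r)%N) (p : X -> 'I_r) a :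
  multilinear (fun b : forall i, lie k (fib p i) => sclass r0 a b).
Proof.
move=> j c b b' b'' ej ei; rewrite /sclass -linearP; apply/lq_piP/lspan_rel.
exact: (@scomp_bot k (Com k) (Lie k) X r r0 p a j c b b' b'' ej ei).
Qed.

(** [G] spells the left-normed brackets of a generator as words; up to order it determines the class
    z, by [presents_perm]. *)
Definition presents (z : S) (G : seq (seq X)) : Prop :=
  exists r (r0 : (0 < r)%N) (p : X -> 'I_r) (t : forall i, mbracket (fib p i)),
  [/\ z = sclass r0 (com_one k _) (fun i => lie_br k (t i)), size G = r
    & forall i : 'I_r, exists m s, nth [::] G i = m :: s /\
        bracket_map val (val (t i)) = left_normed m s].

Lemma mem_block r (p : X -> 'I_r) (t : forall i, mbracket (fib p i)) B i x :
  (exists m s, B = m :: s /\ bracket_map val (val (t i)) = left_normed m s) ->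
  (x \in B) = (p x == i).
Proof.
case=> m [s [-> et]]; rewrite -leaves_left_normed -et leaves_map.
rewrite -has_pred1 has_count.
by rewrite (count_val (P := fun x => p x == i) _ (valP (t i))) lt0b.
Qed.

Lemma bracket_map_inj (T U : Type) (g : T -> U) : injective g ->
  injective (bracket_map g).
Proof.
move=> inj_g; elim=> [x|a IHa b IHb] [y|c d] //=; first by case=> /inj_g ->.
by case=> /IHa -> /IHb ->.
Qed.

(** The permutation matching the two families of words is absorbed by the relation [scomp_sym], as
    it fixes the generator of Com(r). *)
Lemma presents_perm z z' G G' : presents z G -> presents z' G' ->
  perm_eq G G' -> z = z'.
Proof.
case=> r [r0 [p [t [-> sG tG]]]] [r' [r0' [q [t' [-> sG' tG']]]]] pG.
have er : r' = r by rewrite -sG -sG' (perm_size pG).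
move: r0' q t' sG' tG'; rewrite {}er => r0' q t' sG' tG'.
rewrite (bool_irrelevance r0' r0) {r0'}.
have [s sE] : exists s : 'S_r, forall i : 'I_r, nth [::] G' (s i) = nth [::] G i.
  have /tuple_permP[s es] : perm_eq (Tuple (introT eqP sG)) (Tuple (introT eqP sG')).
    exact: pG.
  exists s => i; rewrite /= in es; rewrite es.
  rewrite (nth_map i) ?size_enum_ord // nth_ord_enum.
  by rewrite (tnth_nth [::]).
have qE x : q x = s (p x).
  by apply/eqP; rewrite -(mem_block x (tG' (s (p x)))) sE (mem_block x (tG (p x))).
have bs : bijective s by exists (s^-1)%g; [apply: permK|apply: permKV].
have e1E : com_one k 'I_r = sm_map (Com k) bs (com_one k 'I_r).
  by apply/ffunP => e; rewrite /= (com_mapE _ _ _ e).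
rewrite {2}e1E; apply/esym/lq_piP/lspan_rel.
apply: (@scomp_sym k (Com k) (Lie k) X r r0 p q (com_one k _)
  (fun i => lie_br k (t i)) (fun i => lie_br k (t' i)) s bs) => // i h bh hE.
rewrite /= lie_map_br; congr lie_br; apply: val_inj.
apply: (bracket_map_inj (g := val)) => [|/=]; first exact: val_inj.
have [m [w [e1 e2]]] := tG i; have [m' [w' [e1' e2']]] := tG' (s i).
rewrite e2'; move: e1'; rewrite sE e1 => -[<- <-]; rewrite -e2.
have hV x : bracket_map val (bracket_map h x) = bracket_map val x.
  by elim: x => [x|a IHa b IHb] /=; [congr bvar; exact: hE|rewrite IHa IHb].
by rewrite [RHS]hV.
Qed.

Definition rank (x : X) : nat := enum_rank x.

Lemma rank_inj : injective rank.
Proof. by move=> x y /val_inj/enum_rank_inj. Qed.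

Definition word_presents (w : seq X) (z : S) : Prop :=
  exists G G', [/\ block_seq rank G', flatten G' = w, perm_eq G' G & presents z G].

Lemma word_presents_unique w z z' : word_presents w z -> word_presents w z' -> z = z'.
Proof.
case=> [G1 [G1' [b1 f1 p1 q1]]] [G2 [G2' [b2 f2 p2 q2]]].
apply: presents_perm q1 q2 _; rewrite -(permPl p1).
by rewrite (flatten_block_seq_inj b1 b2) // f1 f2.
Qed.

(** Only the surjectivity of the induced map As -> Com o Lie is used, so 0 is an admissible value
    for a word that presents nothing. *)
Definition word_class (w : listing X) : S :=
  if pselect (exists z, word_presents (word w) z) is left h then sval (cid h) else 0.

Lemma word_classE w z : word_presents (word w) z -> z = word_class w.
Proof.
move=> wz; rewrite /word_class; case: pselect => [h|[]]; last by exists z.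
exact: word_presents_unique wz (svalP (cid h)).
Qed.

(** The listing concatenates the words of the brackets, sorted by decreasing minimum. *)
Lemma sclass_word_presents r (r0 : (0 < r)%N) (p : X -> 'I_r)
    (t : forall i, mbracket (fib p i)) :
  (forall i, exists m s, val (t i) = left_normed m s /\
     forall y : fib p i, (rank (val m) <= rank (val y))%N) ->
  exists w, sclass r0 (com_one k _) (fun i => lie_br k (t i)) = word_class w.
Proof.
move=> tmin.
have /choice[G0 G0P] i : exists B : seq X, [/\ block rank B,
    exists m s, B = m :: s /\ bracket_map val (val (t i)) = left_normed m s,
    exists m, p m = i /\ bhead rank B = rank m
    & B = map val (leaves (val (t i)))].
  have [m [s [et min_m]]] := tmin i; exists (map val (m :: s)); split.
  - have us : uniq (m :: s).
      by rewrite -leaves_left_normed -et (perm_uniq (valP (t i))) enum_uniq.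
    rewrite /= all_map; apply/allP => y ys /=; rewrite ltn_neqAle min_m andbT.
    case/andP: us => nm _; apply: contraNneq nm => /rank_inj e.
    by rewrite (_ : m = y) //; apply: val_inj.
  - by exists (val m), (map val s); rewrite et left_normed_map.
  - by exists (val m); split; [apply/eqP/(valP m)|].
  by rewrite et leaves_left_normed.
pose G := [seq G0 i | i <- enum 'I_r].
have aG : all (block rank) G by apply/allP => _ /mapP[i _ ->]; case: (G0P i).
have uG : uniq (map (bhead rank) G).
  rewrite -map_comp map_inj_uniq ?enum_uniq // => i j /=.
  have [_ _ [m [<- ->]] _] := G0P i; have [_ _ [m' [<- ->]] _] := G0P j.
  by move=> /rank_inj ->.
have [G' pG bG'] := sort_block_seq aG uG.
have pF : perm_eq (flatten G') (enum X).
  apply: (perm_trans (perm_flatten pG)); apply/perm_enumP => x.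
  rewrite count_flatten -map_comp sumnE big_map big_enum /=.
  have cE i : count_mem x (G0 i) = (p x == i).
    have [_ _ _ ->] := G0P i.
    exact: (count_val (P := fun x => p x == i) _ (valP (t i))).
  under eq_bigr do rewrite cE.
  by rewrite (bigD1 (p x)) //= eqxx big1 // => i /negPf; rewrite eq_sym => ->.
have /is_listingP[w ew] : is_listing (flatten G').
  rewrite /is_listing pF (perm_size pF) -cardE; apply/card_gt0P.
  by have [_ _ [m _] _] := G0P (Ordinal r0); exists m.
exists w; apply: word_classE; rewrite ew; exists G, G'; split=> //.
exists r, r0, p, t; split=> // [|i]; first by rewrite size_map size_enum_ord.
rewrite (nth_map i) ?size_enum_ord // nth_ord_enum.
by case: (G0P i).
Qed.

Lemma lspan_word_class (z : S) : lspan (fun z => exists w, z = word_class w) z.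
Proof.
rewrite -[z]lq_reprK; elim/malg_ind: (lq_repr z) => [|c g v IH].
  by rewrite linear0; apply: lspan0.
rewrite linearP /=; apply: lspanZD => //.
case: g => r r0 p a b; set z0 := lq_pi _ _.
have -> : z0 = sclass r0 a b by [].
rewrite {}/z0 sclass_top.
apply: lspanZ.
apply: (multilinear_span (sclass_multilinear r0 (com_one k _))
  (S := fun i x => exists t m s, [/\ x = lie_br k t, val t = left_normed m s
    & forall y : fib p i, (rank (val m) <= rank (val y))%N])) => [i x|||{}b Sb].
- exact: (lspan_lie_min (rank \o val)).
- exact: lspan0.
- by move=> d x y; apply: lspanZD.
pose t i := sval (cid (Sb i)).
have tE i : exists m s, [/\ b i = lie_br k (t i), val (t i) = left_normed m s
  & forall y : fib p i, (rank (val m) <= rank (val y))%N] := svalP (cid (Sb i)).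
have -> : b = fun i => lie_br k (t i).
  by apply: functional_extensionality_dep => i; have [m [s []]] := tE i.
apply: lspan_rel; apply: sclass_word_presents => i.
by have [m [s [_ e1 e2]]] := tE i; exists m, s.
Qed.

(** With g : As -> Com o Lie onto, zeta o g is a surjective endomorphism of a finite-dimensional
    space, so its kernel is 0 by rank-nullity; since g is onto, the kernel of zeta is 0 too. *)
Lemma zeta_inj (surj : forall u : As k X, exists z, zeta z = u) : injective (@zeta k X).
Proof.
pose g : As k X -> S := as_lift word_class.
have gsurj z : exists u, g u = z.
  elim: (lspan_word_class z) => [|c _ v [w ->] _ [u <-]].
    by exists 0; apply: linear0.
  exists (c *: mono (word w) + u); rewrite /g linearP /=.
  by rewrite as_lift_mono.
pose f : 'End(As k X) := linfun (@zeta k X \o as_lift word_class).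
have ker0 : lker f = 0%VS.
  apply/eqP; rewrite -dimv_eq0; have := limg_ker_dim f fullv.
  have -> : (f @: fullv)%VS = fullv.
    apply/eqP; rewrite eqEsubv subvf; apply/subvP => u _.
    have [z <-] := surj u; have [v <-] := gsurj z.
    by apply/memv_imgP; exists v; rewrite ?memvf // lfunE.
  by rewrite capfv => /eqP; rewrite -[X in _ == X]add0n eqn_add2r.
move=> z z' e; apply/eqP; rewrite -subr_eq0; have [v ev] := gsurj (z - z').
have : v \in lker f.
  by rewrite memv_ker lfunE /= -[as_lift _ _]/(g v) ev linearB /= e subrr.
by rewrite ker0 memv0 -ev => /eqP ->; rewrite /g linear0.
Qed.
End ZetaInjective.

(** * The eigenspace decomposition and the theorem *)

Section EigenspaceDecomposition.
Variables (k : fieldType) (X : finType).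
Hypothesis char0 : [pchar k] =i pred0.
Local Notation E := (fun n => sh_eigenspace k n X).

(** Subtracting an eigenvector u for 2^(m+1) from the component [z m] of its decomposition leaves
    eigenvectors with distinct eigenvalues and sum 0. They all vanish, so u = [z m]. *)
Lemma eigenspace_sym_product n (u : As k X) : (0 < n)%N ->
  u \in sh_eigenspace k n X <-> lspan (@sym_product k X n) u.
Proof.
case: n => // m _; split=> [/sh_eigenspaceP eu|su]; last first.
  exact/sh_eigenspaceP/sh_sym_product.
have [z [Lz [N zN]]] := sym_product_decomposition char0 u.
pose v i := z i - (if i == m then u else 0).
suff v0 : v m = 0.
  by move: v0; rewrite /v eqxx => /eqP; rewrite subr_eq0 => /eqP <-.
apply: (eigenvectors_independent (f := sh k X) (pow2_inj char0)
  (N := maxn N m.+1)) => [i||]; last by rewrite leq_maxr.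
  rewrite linearB /= (sh_sym_product (Lz i)) scalerBr; congr (_ - _).
  by case: eqP => [->|_]; rewrite ?eu ?linear0 ?scaler0.
rewrite sumrB -(zN _ (leq_maxl _ _)) -big_mkcond /=.
by rewrite (big_pred1 (Ordinal (leq_maxr N m.+1))) ?subrr // => i; apply: val_eqE.
Qed.

Lemma eigenspaces_direct_sum : is_direct_sum E.
Proof.
split=> [N|u]; last first.
  have [z [Lz [N zN]]] := sym_product_decomposition char0 u.
  exists N; rewrite [u](zN N) //; apply: memv_sumr => i _.
  exact/(eigenspace_sym_product _ (ltn0Sn i)).
apply/directv_sum_independent => u Eu s0 i _.
(* The finite family is extended by 0 to all indices. *)
pose v n := if insub n is Some j then u j else 0.
have vE (j : 'I_N) : v j = u j by rewrite /v valK.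
rewrite -vE; apply: (eigenvectors_independent (f := sh k X) (pow2_inj char0)
  (N := N)) => // [n|].
  rewrite /v; case: insubP => [j _ <-|_]; last by rewrite linear0 scaler0.
  exact/sh_eigenspaceP/Eu.
by under eq_bigr do rewrite vE.
Qed.

Lemma zeta_surj (u : As k X) : exists z, zeta z = u.
Proof.
have [z [Lz [N /(_ N (leqnn N)) ->]]] := sym_product_decomposition char0 u.
apply: (big_ind (fun u => exists z, @zeta k X z = u)) => [|_ _ [x <-] [y <-]|i _].
- by exists 0; apply: linear0.
- by exists (x + y); rewrite linearD.
by have /zeta_arityP[//|x _ <-] := Lz i; exists x.
Qed.

Lemma zeta_bij : bijective (@zeta k X).
Proof.
have surj u : {z | zeta z = u} := cid (zeta_surj u).
exists (fun u => sval (surj u)) => [z|u]; last exact: svalP (surj u).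
exact: (zeta_inj zeta_surj) (svalP (surj (zeta z))).
Qed.
End EigenspaceDecomposition.

Theorem mainTheorem19 (k : fieldType) (char0 : [pchar k] =i pred0) :
  [/\ (* sh is a morphism of S-modules *)
      (forall (X Y : finType) (f : X -> Y), bijective f ->
        forall u : As k X, sh k Y (as_map f u) = as_map f (sh k X u)),
      (* As is the direct sum of the 2^n-eigenspaces, n >= 1 *)
      (forall X : finType, is_direct_sum (fun n => sh_eigenspace k n X)),
      (* each of them is a sub-Lie-bimodule *)
      (forall n : nat, (0 < n)%N -> lie_subbimodule (sh_eigenspace k n)),
      (* generated by s_n as a right Lie-module *)
      (forall n : nat, (0 < n)%N -> forall (X : finType) (u : As k X),
        u \in sh_eigenspace k n X <->
        right_lie_generated (as_sym k 'I_n) u)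
    & (* and zeta : Com o Lie -> As is an isomorphism which identifies
         Com(n) o Lie with the 2^n-eigenspace *)
      (forall X : finType, bijective (@zeta k X)) /\
      (forall n : nat, (0 < n)%N -> forall (X : finType) (u : As k X),
        u \in sh_eigenspace k n X <->
        exists2 z : scomp (Com k) (Lie k) X, scomp_arity n z & zeta z = u)].
Proof.
split.
- by move=> X Y f _ u; apply: sh_as_map.
- by move=> X; apply: eigenspaces_direct_sum.
- by move=> n _; apply: eigenspace_lie_subbimodule.
- move=> n n0 X u; split=> [/(eigenspace_sym_product char0 u n0)|].
    exact: sym_product_generated.
  (* The eigenspace is itself one of the right submodules containing s_n. *)
  apply; first by have [] := eigenspace_lie_subbimodule k n.
  exact/sh_eigenspaceP/sh_sym_ord.
split=> [X|n n0 X u]; first exact: zeta_bij.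
split=> [/(eigenspace_sym_product char0 u n0)/(zeta_arityP u n0) //|].
by move/(zeta_arityP u n0)/(eigenspace_sym_product char0 u n0).
Qed.
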